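(* Let $\Omega=(a,b)\subseteq\mathbb{R}$ be a bounded open interval, $\alpha\in C(\overline\Omega)$ differentiable (in $\Omega$) with $\alpha>0$ on $\overline\Omega$, and $f\in BV(\Omega)$. If $$u=\operatorname*{argmin}_{u\in BV(\Omega)}\ \frac12\int_\Omega (f-u)^2\,dx+\int_\Omega \alpha(x)\,d|Du|,$$ then $$|Du|(\Omega)\le|Df|(\Omega).$$
   Context: For $u\in BV(\Omega)$, $|Du|$ is the total variation measure of the distributional derivative $Du$, so $|Du|(\Omega)$ is the total variation of $u$. The minimisation problem has a unique solution. *)

(* Defs.v *)
From HB Require Import structures.
From mathcomp Require Import all_boot all_order all_algebra.
From mathcomp Require Import all_classical all_reals all_analysis.

Set Implicit Arguments.
Unset Strict Implicit.
Unset Printing Implicit Defensive.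

Import Order.TTheory GRing.Theory Num.Theory.
Import numFieldNormedType.Exports.

Local Open Scope classical_set_scope.
Local Open Scope ring_scope.
Local Open Scope ereal_scope.

Section signed_measures.
Context d (T : measurableType d) (R : realType).
Implicit Types nu : {charge set T -> \bar R}.

Definition hahn_pos nu : set T := projT1 (cid (Hahn_decomposition nu)).

Definition hahn_neg nu : set T :=
  projT1 (cid (projT2 (cid (Hahn_decomposition nu)))).

Lemma hahnP nu : hahn_decomposition nu (hahn_pos nu) (hahn_neg nu).
Proof. exact: (projT2 (cid (projT2 (cid (Hahn_decomposition nu))))). Qed.

Definition pos_part nu : {measure set T -> \bar R} := jordan_pos (hahnP nu).

Definition neg_part nu : {measure set T -> \bar R} := jordan_neg (hahnP nu).

Definition tv_measure nu : {measure set T -> \bar R} :=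
  charge_variation (hahnP nu).

Definition charge_integral nu (D : set T) (g : T -> R) : \bar R :=
  \int[pos_part nu]_(x in D) (g x)%:E - \int[neg_part nu]_(x in D) (g x)%:E.

End signed_measures.

Section BV.
Context (R : realType) (a b : R).
Implicit Types (u phi : R -> R) (nu : {charge set (measurableTypeR R) -> \bar R}).

Local Notation Omega := (`]a, b[%classic : set R).

(* phi belongs to C_c^oo(Omega), extended by 0 to the whole line. *)
Definition test_function phi : Prop :=
  [/\ forall (n : nat) (x : R), derivable (derive1n n phi) x 1%R,
      compact (closure [set x | phi x != 0%R]) &
      closure [set x | phi x != 0%R] `<=` Omega].

(* A finite signed measure on Omega is encoded as a charge on the Borel sets
   of the line that is concentrated on Omega. *)
Definition is_distributional_derivative u nu : Prop :=
  (forall A : set (measurableTypeR R),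
     measurable A -> nu A = nu (A `&` Omega)) /\
  (forall phi, test_function phi ->
     \int[@lebesgue_measure R]_(x in Omega) (u x * derive1 phi x)%:E
     = - charge_integral nu Omega phi).

(* Elements are representatives R -> R; only their values on Omega matter. *)
Record BV := MkBV {
  BV_fun :> R -> R;
  BV_integrable : (@lebesgue_measure R).-integrable Omega (EFin \o BV_fun);
  BV_derivative : exists nu, is_distributional_derivative BV_fun nu }.

(* The derivative is unique as a Borel measure; cid selects the charge. *)
Definition D (u : BV) : {charge set (measurableTypeR R) -> \bar R} :=
  projT1 (cid (BV_derivative u)).

Definition weighted_TV_energy (alpha : R -> R) (f u : BV) : \bar R :=
  (2^-1)%:E * \int[@lebesgue_measure R]_(x in Omega) ((f x - u x) ^+ 2)%:E
  + \int[tv_measure (D u)]_(x in Omega) (alpha x)%:E.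

Definition is_minimizer (alpha : R -> R) (f u : BV) : Prop :=
  forall v : BV, weighted_TV_energy alpha f u <= weighted_TV_energy alpha f v.

End BV.

(* Main.v *)
(** Write [w = u - f] for representatives of bounded variation and
    [Z y = int_y^b w].  Comparing [u] with [u + c], with [u +- t 1_[y,b[] and
    with [(1 - t) u] yields [int w = 0], [|Z| <= alpha], and, for [p] and [q]
    the positive and negative parts of [Du],
    [int (alpha + Z) dp + int (alpha - Z) dq <= 0]; so [Z = - alpha] holds
    [p]-a.e. and [Z = alpha] holds [q]-a.e.  Let [r] be a nondecreasing odd
    [C^{1,1}] function with value [1] beyond [min alpha > 0].  Then
    [psi = - r(Z)] is the sign of [Du], so [|Du| = int psi dDu], whereas
    [int psi d(Du - Df) = - int r'(Z) w^2 <= 0] by integration by parts.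
    Hence [|Du| <= int psi dDf <= |Df|].

    All integrations by parts are instances of Fubini's theorem for
    representatives of the form [k + p ]a, x] - q ]a, x]]; that every element
    of BV has such a representative is the lemma of du Bois-Reymond. *)

(* Truncating at the constant [min alpha], instead of normalising [Z] by [alpha], makes [psi] a
   function of [Z] alone. Since [Z' = - w], its derivative [r'(Z) w] carries the sign of [w], whence
   the square. The boundary terms vanish because [int w = 0] forces [Z = 0] at both ends, and
   [r(0) = 0].

   The obstacle is regularity: [Du] may have jumps and a Cantor part, so [w] is only bounded and [Z]
   only Lipschitz. A [C^{1,1}] function [r] has a quadratic Taylor bound, which survives composition
   with a Lipschitz function.

   Competitors are given by arbitrary pairs [(p, q)] of finite measures, not by Jordan
   decompositions: the total variation of [p - q] is at most [p + q], and an upper bound for the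
   energy of a competitor is enough. *)
Require Import Defs.
From HB Require Import structures.
From mathcomp Require Import all_boot all_order all_algebra.
From mathcomp Require Import all_classical all_reals all_analysis.
From mathcomp Require Import measurable_realfun ring lra.
Import Order.TTheory GRing.Theory Num.Theory.
Import numFieldNormedType.Exports.
Local Open Scope classical_set_scope.
Local Open Scope ring_scope.
Set Implicit Arguments.
Unset Strict Implicit.
Unset Printing Implicit Defensive.

(** * Smooth bumps *)

Section Bumps.
Context {R : realType}.
Implicit Types (f g F : R -> R) (p : {poly R}).

(** Serves where no formula can be differentiated: at the origin for [flat], and in the chain rule
    for [tailint]. *)
Lemma quadratic_is_derive0 f (x C : R) :
  (forall y, `|f y - f x| <= C * (y - x) ^+ 2) -> is_derive x 1 f 0.
Proof.
move=> fC; have C0 : 0 <= C.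
  have := fC (x + 1); rewrite addrAC subrr add0r expr1n mulr1.
  exact: le_trans.
suff H : h^-1 *: ((f \o shift x) (h *: (1:R)) - f x) @[h --> 0^'] --> (0:R).
  by split; [apply/cvg_ex; exists 0|exact: cvg_lim].
apply/cvgrPdist_le => /= e e0.
near=> h.
rewrite sub0r normrN /= !scaler1.
have h0 : h != 0 by near: h; exact: nbhs_dnbhs_neq.
rewrite normrM normfV ler_pdivrMl ?normr_gt0//.
rewrite (le_trans (fC _))// addrK -real_normK ?num_real// expr2 mulrA.
rewrite mulrC ler_pM2l ?normr_gt0//.
rewrite (@le_trans _ _ ((C + 1) * `|h|))//.
  by rewrite ler_pM2r ?normr_gt0// lerDl.
rewrite -ler_pdivlMl ?ltr_wpDl//.
near: h; apply: dnbhs0_le.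
by rewrite mulr_gt0// invr_gt0 ltr_wpDl.
Unshelve. all: by end_near. Qed.

Definition smooth f := forall n x, derivable (derive1n n f) x 1.

(** Coinduction on a class closed under [derive1], so that no formula for the n-th derivative is
    ever required. *)
Lemma smooth_coind (P : (R -> R) -> Prop) :
  (forall f, P f -> (forall x, derivable f x 1) /\ P (derive1 f)) ->
  forall f, P f -> smooth f.
Proof.
move=> HP f Pf n; have : P (derive1n n f).
  by elim: n => // n /HP[_]; rewrite -derive1nS.
by move=> /HP[].
Qed.

Lemma smooth_derive1 f : smooth f -> smooth (derive1 f).
Proof.
move=> sf n x; have := sf n.+1 x.
by rewrite /derive1n iterSr.
Qed.

(** Invariant for [smoothM]: sums of products of derivatives are closed under the product rule,
    which avoids the binomial coefficients of Leibniz's formula. *)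
Inductive leibniz_sum f g : (R -> R) -> Prop :=
| leibniz_prod i j : leibniz_sum f g (fun x => derive1n i f x * derive1n j g x)
| leibniz_add h k : leibniz_sum f g h -> leibniz_sum f g k ->
    leibniz_sum f g (fun x => h x + k x).

Lemma smoothM f g : smooth f -> smooth g -> smooth (fun x => f x * g x).
Proof.
move=> sf sg; apply: (@smooth_coind (leibniz_sum f g)); last first.
  exact: (leibniz_prod f g 0 0).
move=> h; elim=> [i j|h1 h2 _ [d1 l1] _ [d2 l2]].
  split=> [x|]; first exact: derivableM.
  rewrite (_ : derive1 _ = fun x => derive1n i f x * derive1n j.+1 g x +
     derive1n i.+1 f x * derive1n j g x).
    by apply: leibniz_add; exact: leibniz_prod.
  apply/funext => x; rewrite derive1E deriveM// !derive1nS !derive1E.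
  by congr (_ + _); exact: mulrC.
split=> [x|]; first exact: derivableD.
rewrite (_ : derive1 _ = fun x => derive1 h1 x + derive1 h2 x); first exact: leibniz_add.
by apply/funext => x; rewrite !derive1E deriveD.
Qed.

Lemma smooth_cst (c : R) : smooth (fun=> c).
Proof.
apply: (@smooth_coind (fun f => exists k, f = fun=> k)); last by exists c.
move=> _ [k ->]; split=> [x|]; first exact: derivable_cst.
by exists 0; apply/funext => x; rewrite derive1_cst.
Qed.

Lemma smoothD f g : smooth f -> smooth g -> smooth (fun x => f x + g x).
Proof.
move=> sf sg; apply: (@smooth_coind (fun h => exists f1 g1,
  [/\ smooth f1, smooth g1 & h = fun x => f1 x + g1 x])); last by exists f, g.
move=> _ [f1 [g1 [sf1 sg1 ->]]]; have df := sf1 0; have dg := sg1 0.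
split=> [x|]; first exact: derivableD.
exists (derive1 f1), (derive1 g1); split; [exact: smooth_derive1..|].
by apply/funext => x; rewrite !derive1E deriveD.
Qed.

Lemma smooth_primitive F f : (forall x : R, is_derive x 1 F (f x)) -> smooth f ->
  smooth F.
Proof.
move=> dF sf [|n] x; first by have [] := dF x.
rewrite /derive1n iterSr (_ : derive1 F = f); first exact: sf.
by apply/funext => y; rewrite derive1E; have [] := dF y.
Qed.

(** The exponent [m] is free because peeling off [p * 'X + c%:P] turns [m] into [m.+1]; the case
    [m = 2] makes [flat] differentiable at 0. *)
Lemma poly_le_expR (k : R) p m : 0 < k ->
  exists2 C : R, 0 <= C & forall t : R, 0 < t -> t ^+ m * `|p.[t]| <= C * expR (k * t).
Proof.
move=> k0; elim/poly_ind: p m => [|p c ih] m.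
  by exists 0 => // t _; rewrite horner0 normr0 mulr0 mul0r.
have [C1 C10 H1] := ih m.+1.
have [C2 C20 H2] : exists2 C : R, 0 <= C &
    forall t : R, 0 < t -> t ^+ m <= C * expR (k * t).
  clear H1; case: m => [|m].
    exists 1 => // t t0; rewrite expr0 mul1r -expR0 ler_expR.
    by rewrite mulr_ge0// ltW.
  (* With [n = m.+1], the inequality [t <= (n / k) e^(k t / n)] is raised to the power [n]. *)
  have r0 : 0 < m.+1%:R / k by rewrite divr_gt0.
  exists ((m.+1%:R / k) ^+ m.+1); first by rewrite exprn_ge0// ltW.
  move=> t t0.
  have -> : k * t = m.+1%:R * (k / m.+1%:R * t).
    by rewrite mulrA mulrCA mulfV ?mulr1.
  have le_t : t <= m.+1%:R / k * expR (k / m.+1%:R * t).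
    rewrite -ler_pdivrMl// invf_div (le_trans _ (expR_ge1Dx _))// lerDr//.
  rewrite expRM_natl -exprMn; apply: lerXn2r => //; rewrite nnegrE ?(ltW t0)//.
  exact: le_trans (ltW t0) le_t.
exists (C1 + `|c| * C2); first by rewrite addr_ge0// mulr_ge0.
move=> t t0; rewrite hornerMXaddC mulrDl.
apply: (@le_trans _ _ (t ^+ m.+1 * `|p.[t]| + `|c| * t ^+ m)).
  rewrite exprSr -mulrA [`|c| * _]mulrC -mulrDr.
  rewrite ler_wpM2l ?(exprn_ge0 _ (ltW t0))// (le_trans (ler_normD _ _))//.
  by rewrite normrM (gtr0_norm t0) mulrC.
by rewrite lerD ?H1// -mulrA ler_wpM2l// H2.
Qed.

Definition flat (k : R) p (x : R) :=
  if 0 < x then p.[x^-1] * expR (- (k * x^-1)) else 0.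

(* The chain rule gives [(p(1/x) e^(-k/x))' = (k p - p')(1/x) x^(-2) e^(-k/x)],
   so the functions [flat k p] are closed under differentiation. *)
Definition flat' (k : R) p := 'X^2 * (k%:P * p - p^`()).

Lemma flat_is_derive (k : R) p (x : R) : 0 < k ->
  is_derive x 1 (flat k p) (flat k (flat' k p) x).
Proof.
move=> k0; rewrite {2}/flat; case: ltrgtP => // x0.
- have xN0 : x != 0 by rewrite gt_eqF.
  apply: (@near_eq_is_derive _ _ _ (fun y : R => p.[y^-1] * expR (- (k * y^-1)))).
    by near=> y; rewrite /flat ifT//; near: y; exact: lt_nbhsr.
  have dV : is_derive x 1 (fun y : R => y^-1) (- x ^- 2).
    have := @is_deriveV _ (id : R -> R) x 1 1 xN0 (is_derive_id _ _).
    by rewrite scaler1.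
  have d1 : is_derive x 1 (fun y : R => p.[y^-1]) (p^`().[x^-1] * - x ^- 2).
    exact: (@is_derive1_comp _ (horner p) (fun y : R => y^-1)).
  have d2 : is_derive x 1 (fun y : R => expR (- (k * y^-1)))
      (expR (- (k * x^-1)) * (k * x ^- 2)).
    apply: (@is_derive1_comp _ expR (fun y : R => - (k * y^-1))).
    have := @is_deriveZ _ _ _ (fun y : R => y^-1) (- k) x 1 _ dV.
    rewrite scalerN scaleNr opprK => H.
    by rewrite (_ : (fun _ => _) = (- k) *: (fun y : R => y^-1))//;
      apply/funext => y /=; rewrite -mulNr.
  refine (is_derive_eq (is_deriveM d1 d2) _).
  rewrite /flat' !hornerE !exprVn.
  set E := expR _; rewrite /GRing.scale /=; ring.
- apply: (@near_eq_is_derive _ _ _ (fun _ : R => 0 : R)).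
    near=> y; rewrite /flat ifF//; apply/negbTE; rewrite -leNgt ltW//.
    by near: y; exact: lt_nbhsl.
(* At 0, the bound for [t = y^-1] and [m = 2] reads [|flat k p y| <= C y^2]. *)
- rewrite -x0.
  have [C C0 HC] := poly_le_expR p 2 k0.
  apply: (@quadratic_is_derive0 _ _ C) => y.
  rewrite /flat ltxx !subr0; case: ltP => y0; last first.
    by rewrite normr0 mulr_ge0// sqr_ge0.
  have yV0 : 0 < y^-1 by rewrite invr_gt0.
  have := HC _ yV0.
  rewrite exprVn ler_pdivrMl ?exprn_gt0// => H.
  rewrite normrM (gtr0_norm (expR_gt0 _)) expRN ler_pdivrMr ?expR_gt0//.
  by rewrite (le_trans H)// mulrA [C * _]mulrC.
Unshelve. all: by end_near. Qed.

Lemma smooth_flat_affine (k s c : R) p : 0 < k ->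
  smooth (fun x => flat k p (s * x + c)).
Proof.
move=> k0.
apply: (@smooth_coind (fun f => exists q, f = fun x => flat k q (s * x + c)));
  last by exists p.
move=> _ [q ->].
have D (x : R) : is_derive x 1 (fun x : R => flat k q (s * x + c))
    (flat k (s *: flat' k q) (s * x + c)).
  have da : is_derive x 1 (fun x : R => s * x + c) s.
    have := is_deriveD (is_deriveZ s (is_derive_id x (1:R))) (is_derive_cst c x (1:R)).
    by rewrite addr0 scaler1.
  have df := flat_is_derive q (s * x + c) k0.
  pose aff (x : R) := s * x + c.
  refine (is_derive_eq (@is_derive1_comp _ (flat k q) aff x _ _ df da) _).
  by rewrite /flat; case: ifP => _; rewrite ?mul0r// hornerZ mulrC mulrA.
split=> [x|]; first by have [] := D x.
by exists (s *: flat' k q); apply/funext => x; rewrite derive1E; case: (D x).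
Qed.

(** The rates [1/(n+1)] tend to 0, so the bumps tend to the indicator of []c, d[] while staying
    between 0 and 1: dominated convergence takes the place of mollification. *)
Definition exp_bump (c d : R) (n : nat) (x : R) :=
  flat n.+1%:R^-1 1 (x - c) * flat n.+1%:R^-1 1 (d - x).

Lemma smooth_bump (c d : R) n : smooth (exp_bump c d n).
Proof.
have k0 : 0 < n.+1%:R^-1 :> R by rewrite invr_gt0.
have := smoothM (@smooth_flat_affine _ 1 (- c) 1 k0)
                (@smooth_flat_affine _ (-1) d 1 k0).
rewrite (_ : (fun _ => _) = exp_bump c d n)//.
by apply/funext => x; rewrite /exp_bump mul1r mulN1r [- x + d]addrC.
Qed.

Lemma flat1E (k x : R) : flat k 1 x = if 0 < x then expR (- (k * x^-1)) else 0.
Proof. by rewrite /flat -[1 : {poly R}]/(1%:P) hornerC mul1r. Qed.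

Lemma flat1_ge0 (k x : R) : 0 <= flat k 1 x.
Proof. by rewrite flat1E; case: ifP => // _; exact: expR_ge0. Qed.

Lemma flat1_le1 (k x : R) : 0 <= k -> flat k 1 x <= 1.
Proof.
move=> k0; rewrite flat1E; case: ifP => // x0.
by rewrite -expR0 ler_expR oppr_le0 mulr_ge0// invr_ge0 ltW.
Qed.

Lemma bump_ge0 (c d : R) n (x : R) : 0 <= exp_bump c d n x.
Proof. by rewrite mulr_ge0// flat1_ge0. Qed.

Lemma bump_le1 (c d : R) n (x : R) : exp_bump c d n x <= 1.
Proof.
by rewrite /exp_bump -[leRHS](mulr1 1) ler_pM ?flat1_ge0// flat1_le1.
Qed.

Lemma bump_eq0 (c d : R) n (x : R) : x \notin `]c, d[ -> exp_bump c d n x = 0.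
Proof.
rewrite in_itv/= negb_and -!leNgt /exp_bump /flat !subr_gt0.
by case/orP => h; [rewrite (ltNge c) h mul0r|rewrite (ltNge x) h mulr0].
Qed.

(** The argument moves with [n] because the endpoints in [inner_bump] do. *)
Lemma cvg_flat1 (u : nat -> R) (x : R) : 0 < x -> u n @[n --> \oo] --> x ->
  flat n.+1%:R^-1 1 (u n) @[n --> \oo] --> (1:R).
Proof.
move=> x0 ux.
have H : expR (- (n.+1%:R^-1 * (u n)^-1)) @[n --> \oo] --> (1:R).
  rewrite -[X in _ --> X]expR0.
  apply: continuous_cvg; first exact: continuous_expR.
  rewrite -[X in _ --> X]oppr0; apply: cvgN.
  rewrite -[X in _ --> X](mul0r x^-1); apply: cvgM; first exact: cvg_harmonic.
  by apply: cvgV => //; rewrite gt_eqF.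
apply: cvg_trans H; apply: near_eq_cvg; near=> n; rewrite flat1E ifT//.
by near: n; apply: (cvgr_gt x).
Unshelve. all: by end_near. Qed.

(* Shrinking the support makes these test functions of ]a, b[ even when c = a or
   d = b. *)
Definition inner_bump (c d : R) (n : nat) :=
  exp_bump (c + n.+1%:R^-1) (d - n.+1%:R^-1) n.

Lemma cvg_inner_bump (c d x : R) :
  inner_bump c d n x @[n --> \oo] --> (\1_(`]c, d[%classic) x : R).
Proof.
have cvg_r (y : R) : y + n.+1%:R^-1 @[n --> \oo] --> y.
  by rewrite -[X in _ --> X]addr0; apply: cvgD; [exact: cvg_cst|exact: cvg_harmonic].
have cvg_l (y : R) : y - n.+1%:R^-1 @[n --> \oo] --> y.
  by rewrite -[X in _ --> X]subr0; apply: cvgB; [exact: cvg_cst|exact: cvg_harmonic].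
rewrite indicE mem_setE; case: (boolP (x \in `]c, d[)) => xcd.
  move: (xcd); rewrite in_itv/= => /andP[cx xd].
  rewrite -[X in _ --> X](mulr1 1); apply: cvgM.
    apply: (@cvg_flat1 _ (x - c)); first by rewrite subr_gt0.
    by apply: cvgB; [exact: cvg_cst|exact: cvg_r].
  apply: (@cvg_flat1 _ (d - x)); first by rewrite subr_gt0.
  by apply: cvgB; [exact: cvg_l|exact: cvg_cst].
rewrite /= (_ : (fun _ => _) = fun=> 0); first exact: cvg_cst.
apply/funext => n; rewrite /inner_bump bump_eq0//; apply: contra xcd.
by rewrite !in_itv/= => /andP[cx xd]; rewrite (lt_trans _ cx) ?(lt_trans xd)//
  ?ltrDl ?gtrBl.
Qed.

Lemma test_function_supp (a b c d : R) f : a < c -> d < b ->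
  (forall x, x \notin `[c, d] -> f x = 0) -> smooth f -> test_function a b f.
Proof.
move=> ac db f0 sf.
have sub : closure [set x | f x != 0] `<=` `[c, d]%classic.
  have -> : `[c, d]%classic = closure `[c, d]%classic.
    by apply/closure_id; exact: itv_closed.
  apply: closure_subset => x /=; apply: contra_neqT => /f0//.
split=> //.
- apply: (subclosed_compact _ (@segment_compact _ c d)) => //.
  exact: closed_closure.
- by apply: (subset_trans sub); apply: subset_itv; rewrite bnd_simp.
Qed.

Lemma test_bump (a b c d : R) n : a < c -> d < b ->
  test_function a b (exp_bump c d n).
Proof.
move=> ac db; apply: (test_function_supp ac db); last exact: smooth_bump.
move=> x xcd; apply: bump_eq0; apply: contra xcd; apply: subset_itv_oo_cc.
Qed.

Lemma test_inner_bump (a b c d : R) n : a <= c -> d <= b ->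
  test_function a b (inner_bump c d n).
Proof.
move=> ac db; apply: test_bump.
  by rewrite (le_lt_trans ac)// ltrDl.
by rewrite (lt_le_trans _ db)// gtrBl.
Qed.

End Bumps.

(** * Bounded Borel functions and finite measures *)

Section FiniteMeasureAdd.
Context d (T : measurableType d) (R : realType).
Variables p q : {finite_measure set T -> \bar R}.

Let fin_num_measure_add : fin_num_fun (measure_add p q).
Proof. by move=> U mU; rewrite measure_addE fin_numD !fin_num_measure. Qed.

(* The library only provides the measure structure on the unfolding [msum]. *)
HB.instance Definition _ := Measure.copy (measure_add p q)
  (msum (fun n => if n is 0%N then p : {measure set T -> \bar R} else q) 2).
HB.instance Definition _ :=
  @Measure_isFinite.Build _ _ _ (measure_add p q) fin_num_measure_add.
End FiniteMeasureAdd.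

Section Bounded.
Context {R : realType}.
Local Notation RR := (measurableTypeR R).
Implicit Types g h : R -> R.

(* [measurableTypeR R] has the same Borel sets as the default structure of [R],
   but a different display; [lebesgue_measure] lives on the former. *)
Definition bmeas g :=
  measurable_fun [set: RR] g /\ exists M, forall x, `|g x| <= M.

Lemma bmeas_cst (c : R) : bmeas (fun=> c).
Proof. by split; [exact: measurable_cst|exists `|c|]. Qed.

Lemma bmeasN g : bmeas g -> bmeas (fun x => - g x).
Proof.
move=> [mg [M gM]]; split; first exact: measurableT_comp.
by exists M => x; rewrite normrN.
Qed.

Lemma bmeasD g h : bmeas g -> bmeas h -> bmeas (fun x => g x + h x).
Proof.
move=> [mg [M gM]] [mh [N hN]]; split; first exact: measurable_funD.
by exists (M + N) => x; rewrite (le_trans (ler_normD _ _))// lerD.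
Qed.

Lemma bmeasB g h : bmeas g -> bmeas h -> bmeas (fun x => g x - h x).
Proof. by move=> bg bh; apply: bmeasD => //; exact: bmeasN. Qed.

Lemma bmeasM g h : bmeas g -> bmeas h -> bmeas (fun x => g x * h x).
Proof.
move=> [mg [M gM]] [mh [N hN]]; split; first exact: measurable_funM.
by exists (M * N) => x; rewrite normrM ler_pM.
Qed.

Lemma bmeasZ (c : R) g : bmeas g -> bmeas (fun x => c * g x).
Proof. by apply: bmeasM; exact: bmeas_cst. Qed.

Lemma bmeas_indic (A : set RR) : measurable A -> bmeas \1_A.
Proof.
move=> mA; split; first exact: measurable_indic.
by exists 1 => x; rewrite indicE; case: (_ \in _); rewrite ?normr1 ?normr0.
Qed.

Lemma lipschitz_continuous h (K : R) :
  (forall x y, `|h x - h y| <= K * `|x - y|) -> continuous h.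
Proof.
move=> lip x; have K1 : 0 < K + 1.
  rewrite ltr_wpDl//; have := lip 1 0; rewrite subr0 normr1 mulr1.
  exact: le_trans.
apply/cvgrPdist_le => /= e e0; near=> y.
rewrite (le_trans (lip _ _))// (@le_trans _ _ ((K + 1) * `|x - y|))//.
  by rewrite ler_wpM2r// lerDl.
rewrite -ler_pdivlMl//; near: y.
by apply: cvgr_dist_le; rewrite // mulr_gt0// invr_gt0.
Unshelve. all: by end_near. Qed.

Lemma bmeas_lipschitz_comp g h (K : R) : bmeas g ->
  (forall x y, `|h x - h y| <= K * `|x - y|) -> bmeas (fun x => h (g x)).
Proof.
move=> [mg [M gM]] lip; split.
  apply: measurableT_comp => //; apply: continuous_measurable_fun.
  exact: lipschitz_continuous lip.
exists (`|h 0| + K * M) => x; rewrite -[h (g x)](subrK (h 0)) addrC.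
rewrite (le_trans (ler_normD _ _))// lerD2l (le_trans (lip _ _))// subr0.
rewrite ler_wpM2l//; have := lip 1 0; rewrite subr0 normr1 mulr1.
exact: le_trans.
Qed.

Lemma bmeas_integrable (nu : {measure set (measurableTypeR R) -> \bar R})
    (D : set RR) g : measurable D -> (nu D < +oo)%E -> bmeas g ->
  nu.-integrable D (EFin \o g).
Proof.
move=> mD nuD [mg [M gM]]; apply: measurable_bounded_integrable => //.
  exact: measurable_funTS.
exists M; split; first exact: num_real.
by move=> N MN x _; exact: le_trans (gM x) (ltW MN).
Qed.

Lemma bmeas_integrable_fin (nu : {finite_measure set (measurableTypeR R) -> \bar R})
    (D : set RR) g : measurable D -> bmeas g ->
  nu.-integrable D (EFin \o g).
Proof.
by move=> mD bg; apply: bmeas_integrable => //; rewrite ltey_eq fin_num_measure.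
Qed.

End Bounded.

Lemma measurable_Omega {R : realType} (a b : R) :
  measurable (`]a, b[%classic : set (measurableTypeR R)).
Proof. exact: measurable_itv. Qed.
#[local] Hint Resolve measurable_Omega : core.

(** * Distribution functions, tail integrals and integration by parts *)

Section Omega.
Context {R : realType} (a b : R).
Hypothesis ab : a < b.
Local Notation mu := (@lebesgue_measure R).
Local Notation Om := (`]a, b[%classic : set R).
Local Notation fmeas := {finite_measure set (measurableTypeR R) -> \bar R}.
Local Notation RR := (measurableTypeR R).
Implicit Types (p q : fmeas) (g h : R -> R).

Lemma lebesgue_Omega_fin : (mu Om < +oo)%E.
Proof. by rewrite lebesgue_measure_itv/= lte_fin ab -EFinB ltry. Qed.

Lemma bmeas_leb g : bmeas g -> mu.-integrable Om (EFin \o g).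
Proof. by apply: bmeas_integrable => //; exact: lebesgue_Omega_fin. Qed.

Lemma bmeas_fin p g : bmeas g -> p.-integrable Om (EFin \o g).
Proof. exact: bmeas_integrable_fin. Qed.

Definition cumul p (x : R) := fine (p `]a, x]%classic).

Lemma cumul_nondecreasing p : {homo cumul p : x y / x <= y}.
Proof.
move=> x y xy; rewrite /cumul fine_le ?fin_num_measure//.
by rewrite le_measure ?inE//; apply: subset_itvl; rewrite bnd_simp.
Qed.

Lemma bmeas_cumul p : bmeas (cumul p).
Proof.
split; first by apply: nondecreasing_measurable => //; exact: cumul_nondecreasing.
exists (fine (p setT)) => x; rewrite ger0_norm; last first.
  by rewrite fine_ge0.
by rewrite fine_le ?fin_num_measure// le_measure ?inE.
Qed.

(** For [g = w] this is the [Z] of the overview, extended to the line: constant before [a], zero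
    from [b] on. The closed end at [y] matches that of []a, x]] in [cumul], so that atoms are
    counted correctly. *)
Definition tailint g (y : R) := \int[mu]_(x in Om `&` `[y, +oo[) g x.

(** The bound on [g] is asked only between [y] and [z]: the chain rule applies it to an integrand
    that is small only there. *)
Lemma tailint_dist g (M y z : R) : bmeas g -> 0 <= M -> y <= z ->
  (forall x, y <= x -> x < z -> `|g x| <= M) ->
  `|tailint g y - tailint g z| <= M * (z - y).
Proof.
move=> bg M0 yz gM; rewrite /tailint.
have ig (D : set RR) : measurable D -> D `<=` Om -> mu.-integrable D (EFin \o g).
  by move=> mD DO; apply: integrableS (bmeas_leb bg).
have -> : Om `&` `[y, +oo[ = (Om `&` `[y, z[) `|` (Om `&` `[z, +oo[).
  rewrite -setIUr; congr (_ `&` _); apply/seteqP; split => x /=;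
    rewrite !in_itv/= !andbT.
    by move=> yx; rewrite yx/=; case: (ltP x z); [left|right].
  by move=> [/andP[]//|]; exact: le_trans.
rewrite Rintegral_setU; last 4 first.
- exact: measurableI.
- exact: measurableI.
- by apply: ig; [apply: measurableU; exact: measurableI|move=> x [[]|[]]].
- apply/disj_setPS => x /= [[_]]; rewrite in_itv/= => /andP[_ xz] [_].
  by rewrite in_itv/= andbT leNgt xz.
rewrite addrK.
have mI : measurable (Om `&` `[y, z[ : set RR) by exact: measurableI.
have iI : mu.-integrable (Om `&` `[y, z[) (EFin \o g) by apply: ig.
apply: (le_trans (le_normr_Rintegral mI iI)).
have finI : (mu (Om `&` `[y, z[) < +oo)%E.
  by apply: le_lt_trans lebesgue_Omega_fin; apply: le_measure; rewrite ?inE.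
apply: (@le_trans _ _ (\int[mu]_(x in Om `&` `[y, z[) M)).
  apply: le_Rintegral => //; first exact: integrable_norm.
    by apply: bmeas_integrable => //; exact: bmeas_cst.
  by move=> x [_]; rewrite /= in_itv/= => /andP[yx xz]; exact: gM.
rewrite Rintegral_cst// ler_wpM2l// -lee_fin fineK ?ge0_fin_numE//.
apply: (@le_trans _ _ (mu `[y, z[%classic)).
  by apply: le_measure; rewrite ?inE.
by rewrite lebesgue_measure_itv/= lte_fin; case: ltP => // _; rewrite lee_fin subr_ge0.
Qed.

Lemma tailint_lip g (M : R) : measurable_fun [set: RR] g -> (forall x, `|g x| <= M) ->
  forall y z, `|tailint g z - tailint g y| <= M * `|z - y|.
Proof.
move=> mg gM y z; have M0 : 0 <= M by exact: le_trans (gM 0).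
have bg : bmeas g by split => //; exists M.
case: (leP y z) => yz.
  rewrite (distrC (tailint g z)) [`|z - y|]ger0_norm ?subr_ge0//.
  exact: tailint_dist.
rewrite (distrC z) [`|y - z|]ger0_norm ?subr_ge0 ?(ltW yz)//.
by apply: tailint_dist => //; exact: ltW.
Qed.

Lemma tailint_ge g (y : R) : b <= y -> tailint g y = 0.
Proof.
move=> bz; rewrite /tailint (_ : _ `&` _ = set0) ?Rintegral_set0//.
apply/seteqP; split => x //= []; rewrite !in_itv/= andbT => /andP[_ xb] zx.
by have := lt_le_trans (lt_le_trans xb bz) zx; rewrite ltxx.
Qed.

Lemma tailint_le g (y : R) : y <= a -> tailint g y = \int[mu]_(x in Om) g x.
Proof.
move=> za; rewrite /tailint; congr Rintegral; apply/seteqP; split => x /=; first by case.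
move=> xab; split => //; move: xab; rewrite !in_itv/= andbT => /andP[+ _].
by move=> /ltW /(le_trans za).
Qed.

Lemma bmeas_tailint g : bmeas g -> bmeas (tailint g).
Proof.
move=> [mg [M gM]]; have lip := tailint_lip mg gM; split; last first.
  exists (M * (b - a)) => y.
  have M0 : 0 <= M by exact: le_trans (gM 0).
  case: (leP b y) => [by_|yb].
    by rewrite tailint_ge// normr0 mulr_ge0// subr_ge0 ltW.
  have H z : a <= z -> z <= b -> `|tailint g z| <= M * (b - a).
    move=> az zb; have := lip b z; rewrite (tailint_ge _ (lexx b)) subr0.
    move=> /le_trans; apply.
    by rewrite ler_wpM2l// distrC ger0_norm ?subr_ge0// lerB.
  case: (leP a y) => [ay|ya]; first by apply: H => //; exact: ltW.
  by rewrite (tailint_le _ (ltW ya)) -(tailint_le _ (lexx a)) H// ltW.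
apply: continuous_measurable_fun; apply: (@lipschitz_continuous _ _ M) => x y.
exact: lip.
Qed.

Section Fubini.
Variables (p : fmeas) (g : R -> R).
Hypothesis bg : bmeas g.

(** The kernel [g(x)] on the triangle [y <= x]: integrating out [y] leaves [cumul p x * g x],
    integrating out [x] leaves [tailint g y]. *)
Let h (z : RR * RR) : R :=
  g z.1 * (\1_Om z.1 * (\1_Om z.2 * (if z.2 <= z.1 then 1 else 0))).

Let mh : measurable_fun [set: RR * RR] h.
Proof.
have [mg _] := bg.
apply: measurable_funM; first exact: measurableT_comp.
apply: measurable_funM; first exact: measurableT_comp.
apply: measurable_funM; first exact: measurableT_comp.
apply: measurable_fun_ifT => //.
exact: measurable_fun_ler.
Qed.

Let h_int : (mu \x p)%E.-integrable [set: RR * RR] (EFin \o h).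
Proof.
have [mg [M gM]] := bg.
have mD : measurable (Om `*` setT : set (RR * RR)) by exact: measurableX.
(* [mu] is infinite on the line, so boundedness yields integrability only on the strip over [Om],
   outside which [h] vanishes. *)
suff : (mu \x p)%E.-integrable (Om `*` setT : set (RR * RR)) (EFin \o h).
  move/(integrable_mkcond _ mD).
  rewrite (_ : _ \_ _ = EFin \o h)//; apply/funext => -[x y]; rewrite patchE.
  case: ifPn => //= xy; rewrite /h/= [\1_Om x]indicE memNset ?mul0r ?mulr0//.
  by move: xy => /negP; apply: contra_not => Ox; rewrite inE/=.
apply: measurable_bounded_integrable => //.
- have E := product_measure1E mu p (measurable_Omega a b) (@measurableT _ RR).
  rewrite [X in (X < _)%E]E lte_mul_pinfty//.
  + by rewrite ge0_fin_numE// lebesgue_Omega_fin.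
  + by rewrite ltey_eq fin_num_measure.
- exact: measurable_funTS.
- exists M; split; first exact: num_real.
  move=> N MN [x y] _; apply: le_trans (ltW MN); rewrite /h/= normrM.
  rewrite -[leRHS]mulr1 ler_pM// !indicE.
  by case: (_ \in _); case: (_ \in _); case: ifP;
    rewrite !(mul0r,mulr0,mulr1,normr0,normr1).
Qed.

Lemma fubini_cumul : \int[mu]_(x in Om) (cumul p x * g x) =
  \int[p]_(y in Om) tailint g y.
Proof.
have := Fubini h_int; rewrite /Rintegral => E; congr fine.
transitivity (\int[mu]_x \int[p]_y (h (x, y))%:E)%E.
  rewrite [LHS]integral_mkcond; apply: eq_integral => x _.
  rewrite patchE; case: ifPn => xO; last first.
    rewrite integral0_eq// => y _.
    by rewrite /h/= [\1_Om x]indicE (negbTE xO) mul0r mulr0.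
  have xO' : Om x by rewrite inE in xO.
  rewrite (_ : (fun y => _) =
    (fun y => (g x)%:E * (\1_(`]a, x]%classic) y)%:E)%E); last first.
    apply/funext => y; rewrite /h/= [\1_Om x]indicE xO mul1r -EFinM; congr (_ * _)%:E.
    rewrite !indicE !mem_setE; move: xO' => /=; rewrite !in_itv/= => /andP[ax xb].
    case: (leP y x) => yx; rewrite ?mulr0 ?andbF ?mulr1 ?andbT//.
    by rewrite (le_lt_trans yx xb) andbT.
  rewrite integralZl//; last first.
    by apply: bmeas_integrable_fin => //; exact: bmeas_indic.
  by rewrite integral_indic// setIT /cumul EFinM fineK ?fin_num_measure// muleC.
rewrite E [RHS]integral_mkcond; apply: eq_integral => y _.
rewrite patchE; case: ifPn => yO; last first.
  rewrite integral0_eq// => x _.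
  by rewrite /h/= [\1_Om y]indicE (negbTE yO) mul0r !mulr0.
have -> : (fun x => (h (x, y))%:E) = (EFin \o g) \_ (Om `&` `[y, +oo[).
  apply/funext => x; rewrite patchE /h/= [\1_Om y]indicE yO mul1r.
  rewrite indicE in_setI !mem_setE [x \in `[_, +oo[]in_itv/= andbT.
  by case: (_ \in _); case: leP; rewrite ?mul0r ?mulr0 ?mulr1.
rewrite -integral_mkcond /tailint /Rintegral fineK//.
have mI : measurable (Om `&` `[y, +oo[ : set RR) by exact: measurableI.
apply: integrable_fin_num => //.
exact: integrableS (bmeas_leb bg).
Qed.

End Fubini.

End Omega.

(** * Test functions and distributional derivatives *)

Section TestFunctions.
Context {R : realType} (a b : R).
Hypothesis ab : a < b.
Local Notation RR := (measurableTypeR R).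
Local Notation mu := (@lebesgue_measure R).
Local Notation Om := (`]a, b[%classic : set R).
Local Notation fmeas := {finite_measure set RR -> \bar R}.
Implicit Types (p q : fmeas) (g h phi r : R -> R).

Lemma bmeas_leb_cc g (c d : R) : bmeas g -> mu.-integrable `[c, d] (EFin \o g).
Proof.
apply: bmeas_integrable => //.
have : (mu `[c, d]%classic < +oo)%E by
  rewrite lebesgue_measure_itv/= lte_fin; case: ifP; rewrite ?ltry// -EFinB ltry.
by [].
Qed.

Lemma bmeas_leb_co g (c d : R) : bmeas g -> mu.-integrable `[c, d[ (EFin \o g).
Proof.
move=> bg; apply: integrableS (bmeas_leb_cc c d bg) => //.
by apply: subset_itvl; rewrite bnd_simp.
Qed.

Lemma smooth_continuous phi : smooth phi -> continuous phi.
Proof.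
by move=> sphi x; apply/differentiable_continuous/derivable1_diffP; exact: (sphi 0).
Qed.

Lemma smooth_derivable phi : smooth phi -> forall x, derivable phi x 1.
Proof. by move=> sphi x; exact: (sphi 0). Qed.

Lemma continuous_bmeas g (c d : R) : c <= d -> continuous g ->
  (forall x, x \notin `[c, d] -> g x = 0) -> bmeas g.
Proof.
move=> cd cg g0; split; first exact: continuous_measurable_fun.
have [|e _ ge] := @EVT_max R (fun x => `|g x|) c d cd.
  by apply: continuous_subspaceT => x; apply: continuous_comp;
    [exact: cg|exact: norm_continuous].
exists `|g e| => x; case: (boolP (x \in `[c, d])) => [/ge//|/g0 ->].
by rewrite normr0.
Qed.

Lemma test_smooth phi : test_function a b phi -> smooth phi.
Proof. by case. Qed.

Lemma test_eq0 phi : test_function a b phi ->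
  forall x, ~ Om x -> phi x = 0 /\ derive1 phi x = 0.
Proof.
move=> [_ _ sub] x Ox.
have nx : \forall y \near x, 0 = phi y.
  have : open (~` closure [set x | phi x != 0]).
    by apply: closed_openC; exact: closed_closure.
  rewrite openE => /(_ x); rewrite /interior/= => H.
  have /H : (~` closure [set x | phi x != 0]) x by move/sub.
  apply: filterS => y /= H1; apply/esym/eqP/negPn/negP => y0; apply: H1.
  exact: subset_closure.
split; first by rewrite -(nbhs_singleton nx).
rewrite derive1E -(near_eq_derive (1 : R) nx); exact: derive_cst.
Qed.

Lemma bmeas_test phi : test_function a b phi -> bmeas phi.
Proof.
move=> tphi; apply: (continuous_bmeas (ltW ab)).
  exact/smooth_continuous/test_smooth.
move=> x xab; apply: (test_eq0 tphi _).1 => /= xO; move/negP: xab; apply.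
exact: subset_itv_oo_cc.
Qed.

Lemma continuous_test_derive phi : test_function a b phi ->
  continuous (derive1 phi).
Proof.
by move=> tphi; apply: smooth_continuous; apply: smooth_derive1; exact: test_smooth.
Qed.

Lemma bmeas_test_derive phi : test_function a b phi -> bmeas (derive1 phi).
Proof.
move=> tphi; apply: (continuous_bmeas (ltW ab)).
  exact: continuous_test_derive.
move=> x xab; apply: (test_eq0 tphi _).2 => /= xO; move/negP: xab; apply.
exact: subset_itv_oo_cc.
Qed.

Lemma integral_test_derive phi y : test_function a b phi -> a <= y -> y < b ->
  (\int[mu]_(x in `[y, b]) (derive1 phi x)%:E = - (phi y)%:E)%E.
Proof.
move=> tphi ay yb; have cphi := smooth_continuous (test_smooth tphi).
have phib : phi b = 0.
  by apply: (test_eq0 tphi _).1; rewrite /= in_itv/= ltxx andbF.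
rewrite (@continuous_FTC2 _ _ phi _ _ yb).
- by rewrite phib sub0e.
- by apply: continuous_subspaceT; exact: continuous_test_derive.
- split.
  + by move=> x _; apply: smooth_derivable; exact: test_smooth.
  + by apply: cvg_at_right_filter; exact: cphi.
  + by apply: cvg_at_left_filter; exact: cphi.
- by [].
Qed.

Lemma tailint_test phi y : test_function a b phi -> Om y ->
  tailint a b (derive1 phi) y = - phi y.
Proof.
move=> tphi Oy; have /andP[ay yb] := Oy : a < y < b.
rewrite /tailint (_ : _ `&` _ = `[y, b[%classic); last first.
  apply/seteqP; split => x /=; rewrite !in_itv/= andbT.
    by move=> [/andP[_ ->] ->].
  by move=> /andP[yx xb]; rewrite yx xb (lt_le_trans ay yx).
rewrite Rintegral_itv_bndo_bndc; last first.
  by apply: bmeas_leb_co; exact: bmeas_test_derive.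
by rewrite /Rintegral integral_test_derive// ltW.
Qed.

Lemma Rintegral_test_derive phi : test_function a b phi ->
  \int[mu]_(x in Om) derive1 phi x = 0.
Proof.
move=> tphi; have id := bmeas_test_derive tphi.
rewrite Rintegral_itv_obnd_cbnd; last exact: bmeas_leb.
rewrite Rintegral_itv_bndo_bndc; last exact: bmeas_leb_co.
have phia : phi a = 0.
  by apply: (test_eq0 tphi _).1; rewrite /= in_itv/= ltxx.
by rewrite /Rintegral integral_test_derive// phia oppe0.
Qed.

Lemma cvg_integral_inner_bump (nu : {measure set RR -> \bar R}) r (c d : R) :
  nu.-integrable Om (EFin \o r) ->
  (\int[nu]_(x in Om) (r x * inner_bump c d n x)%:E @[n --> \oo] -->
  \int[nu]_(x in Om `&` `]c, d[) (r x)%:E)%E.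
Proof.
move=> ir; have mr := measurable_int _ ir.
have mb n : measurable_fun [set: RR] (inner_bump c d n).
  by apply: continuous_measurable_fun; apply: smooth_continuous; exact: smooth_bump.
rewrite integral_mkcondr.
rewrite (_ : _ \_ _ = fun x => ((r x)%:E * (\1_(`]c, d[%classic) x)%:E)%E); last first.
  apply/funext => x; rewrite patchE indicE.
  by case: ifP => _; rewrite ?mule1 ?mule0.
have [] := @dominated_convergence _ _ _ nu Om (measurable_Omega a b)
  (fun n x => (r x * inner_bump c d n x)%:E)
  (fun x => (r x)%:E * (\1_(`]c, d[%classic) x)%:E)%E
  (fun x => `|(r x)%:E|%E).
- move=> n; apply/measurable_EFinP; apply: measurable_funM.
    exact/measurable_EFinP.
  exact: measurable_funTS.
- apply: emeasurable_funM => //.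
  by apply/measurable_EFinP; exact: measurable_indic.
- apply: aeW => x Ox; rewrite -EFinM; apply: cvg_EFin; first exact: nearW.
  rewrite /=.
  by apply: cvgM; [exact: cvg_cst|exact: cvg_inner_bump].
- exact: integrable_abse.
- apply: aeW => x n Ox; rewrite lee_fin normrM (ger0_norm (bump_ge0 _ _ _ _)).
  by rewrite -[leRHS]mulr1 ler_wpM2l//; exact: bump_le1.
by [].
Qed.

Lemma itv_oo_setI (c d : R) :
  Om `&` `]c, d[ = `](Num.max a c), (Num.min b d)[%classic.
Proof.
apply/seteqP; split => x /=; rewrite !in_itv/= gt_max lt_min.
  by move=> [/andP[-> ->] /andP[-> ->]].
by move=> /andP[/andP[-> ->] /andP[-> ->]].
Qed.

(** Integrals of inner bumps converge to the measures of open intervals inside [Om], and open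
    intervals form a pi-system generating the Borel sets. *)
Lemma fmeas_test_eq p q :
  (forall phi, test_function a b phi ->
     \int[p]_(x in Om) (phi x)%:E = \int[q]_(x in Om) (phi x)%:E)%E ->
  forall A : set RR, measurable A -> A `<=` Om -> p A = q A.
Proof.
move=> pq A mA AO.
have pqi (c d : R) : p (Om `&` `]c, d[) = q (Om `&` `]c, d[).
  (* Clipping to []a, b[] makes the approximating bumps test functions. *)
  pose c' := Num.max a c; pose d' := Num.min b d.
  have cvg_meas (nu : fmeas) :
      (\int[nu]_(x in Om) (inner_bump c' d' n x)%:E @[n --> \oo] -->
       nu (Om `&` `]c, d[))%E.
    have := @cvg_integral_inner_bump nu (fun=> 1) c' d' (bmeas_fin _ _ _ (bmeas_cst 1)).
    rewrite -!itv_oo_setI setIA setIid integral_cst; last exact: measurableI.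
    rewrite mul1e; under eq_fun do under eq_integral do rewrite mul1r.
    by [].
  have E n : (\int[p]_(x in Om) (inner_bump c' d' n x)%:E =
      \int[q]_(x in Om) (inner_bump c' d' n x)%:E)%E.
    by apply: pq; apply: test_inner_bump; rewrite ?le_max ?ge_min lexx.
  have := cvg_meas p; under eq_fun do rewrite E.
  by move=> /cvg_unique; apply => //; exact: cvg_meas.
have mO := measurable_Omega a b.
suff : mrestr p mO A = mrestr q mO A by rewrite /mrestr (setIidl AO).
pose G : set (set RR) := @RGenOpens.G R.
pose g (k : nat) : set RR := `](- (k%:R : R)), k%:R[%classic.
apply: (@measure_unique _ R RR G g _ _ _ _ _ _ _ _ A mA).
- exact: RGenOpens.measurableE.
- move=> _ _ [x [y ->]] [x' [y' ->]].
  exists (Num.max x x'), (Num.min y y'); apply/seteqP; split => z /=;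
    rewrite !in_itv/= gt_max lt_min.
    by move=> [/andP[-> ->] /andP[-> ->]].
  by move=> /andP[/andP[-> ->] /andP[-> ->]].
- by move=> k; exists (- k%:R), k%:R.
- apply/seteqP; split => // x _; exists (Num.bound `|x|) => //=.
  rewrite /g/= in_itv/= -ltr_norml; exact: archi_boundP.
- by move=> _ [x [y ->]]; rewrite /= /mrestr setIC pqi setIC.
- move=> k; have mg : measurable (g k) by exact: measurable_itv.
  by rewrite ltey_eq fin_num_measure.
Qed.

End TestFunctions.

(** * The lemma of du Bois-Reymond *)

Section DuBoisReymond.
Context {R : realType} (a b : R).
Hypothesis ab : a < b.
Local Notation RR := (measurableTypeR R).
Local Notation mu := (@lebesgue_measure R).
Local Notation Om := (`]a, b[%classic : set R).
Local Notation fmeas := {finite_measure set RR -> \bar R}.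
Implicit Types (p q : fmeas) (g h phi r zeta : R -> R).

Lemma integrable_leb_bmeasM r g : mu.-integrable Om (EFin \o r) -> bmeas g ->
  mu.-integrable Om (EFin \o (fun x => r x * g x)).
Proof.
move=> ir [mg [M gM]]; rewrite (_ : _ \o _ = (EFin \o r) \* (EFin \o g))%E//.
apply: integrableMl => //; first exact: measurable_funTS.
exists M; split; first exact: num_real.
by move=> N MN x _; exact: le_trans (gM x) (ltW MN).
Qed.

(** The primitive from -oo vanishes before [c] by the support of [zeta], and after [d] because
    [zeta] has mean zero. *)
Lemma test_primitive zeta (c d : R) : a < c -> d < b -> smooth zeta ->
  (forall x, x \notin `[c, d] -> zeta x = 0) ->
  \int[mu]_(x in Om) zeta x = 0 ->
  exists2 phi, test_function a b phi & derive1 phi = zeta.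
Proof.
move=> ac db sz z0 Iz.
have cz := smooth_continuous sz.
have bz : bmeas zeta.
  apply: (@continuous_bmeas R zeta a b) => //; first exact: ltW.
  move=> x xab; apply: z0; apply: contra xab.
  by apply: subset_itv; rewrite bnd_simp ltW.
have zOm : zeta \_ Om = zeta.
  apply/funext => x; rewrite patchE; case: ifPn => // xO; rewrite z0//.
  apply: contra xO => xcd; rewrite mem_setE.
  by apply: subset_itv xcd; rewrite bnd_simp.
have izT : mu.-integrable [set: RR] (EFin \o zeta).
  rewrite -zOm -restrict_EFin; apply/(integrable_mkcond _ (measurable_Omega a b)).
  exact: bmeas_leb.
have iz (D : set RR) : measurable D -> mu.-integrable D (EFin \o zeta).
  by move=> mD; apply: integrableS izT.
pose F y := \int[mu]_(x in `]-oo, y]) zeta x.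
have dF (y : R) : is_derive y 1 F (zeta y).
  have [|||d1 d2] := @continuous_FTC1 R zeta -oo%O y (y + 1) _ _ _ (cz y).
  - by rewrite ltrDl.
  - exact: iz.
  - by rewrite ltNyr.
  by split; rewrite // -derive1E.
exists F; last by apply/funext => x; rewrite derive1E; have [] := dF x.
apply: (test_function_supp ac db); last exact: smooth_primitive sz.
move=> y; rewrite in_itv/= negb_and -!ltNge => /orP[yc|dy].
  rewrite /F /Rintegral integral0_eq// => x /=; rewrite in_itv/= => xy.
  by rewrite z0// in_itv/= negb_and -ltNge (le_lt_trans xy yc).
rewrite -[RHS]Iz /F Rintegral_mkcond [RHS]Rintegral_mkcond zOm.
congr (Rintegral _ _ _); apply/funext => x; rewrite patchE; case: ifPn => //.
rewrite mem_setE in_itv/= -ltNge => yx; rewrite z0// in_itv/= negb_and -!ltNge.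
by rewrite (lt_trans dy yx) orbT.
Qed.

(** A bump minus the right multiple of a fixed bump [th0] has mean zero, hence is the derivative of
    a test function. So [r - k] is orthogonal to all inner bumps and integrates to 0 over every open
    subinterval. *)
Lemma dubois_reymond r : mu.-integrable Om (EFin \o r) ->
  (forall phi, test_function a b phi -> \int[mu]_(x in Om) (r x * derive1 phi x) = 0) ->
  exists k, ae_eq mu Om (EFin \o r) (cst k%:E).
Proof.
move=> ir r0.
have bib (c d : R) n : bmeas (inner_bump c d n).
  split; first by apply: continuous_measurable_fun;
    apply: smooth_continuous; exact: smooth_bump.
  exists 1 => x; rewrite ger0_norm ?bump_ge0//; exact: bump_le1.
(* If all these integrals vanished, so would their limit [mu Om]. *)
have [n0 I0] : exists n, \int[mu]_(x in Om) inner_bump a b n x != 0.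
  apply/not_existsP => H.
  have ib := bmeas_leb ab (bmeas_cst (1 : R)).
  have := @cvg_integral_inner_bump R a b mu (fun=> 1) a b ib.
  rewrite setIid integral_cst// mul1e.
  have -> : (fun n => \int[mu]_(x in Om) (1 * inner_bump a b n x)%:E)%E = fun=> 0%E.
    apply/funext => n; have /negP/negPn/eqP := H n.
    rewrite /Rintegral => E; rewrite -[LHS]fineK; last first.
      apply: integrable_fin_num => //.
      under [X in _.-integrable _ X]eq_fun do rewrite mul1r.
      exact: bmeas_leb.
    by under eq_integral do rewrite mul1r; rewrite E.
  move=> /(cvg_unique _ (cvg_cst 0%E)) => /(_ (@ereal_hausdorff R)) E.
  have : mu Om = 0%E by exact/esym.
  rewrite lebesgue_measure_itv/= lte_fin ab -EFinB => /eqP.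
  by rewrite eqe subr_eq0 gt_eqF.
pose th0 := inner_bump a b n0.
pose k := (\int[mu]_(x in Om) (r x * th0 x)) / (\int[mu]_(x in Om) th0 x).
exists k.
have H1 (c d : R) n : a <= c -> d <= b ->
    \int[mu]_(x in Om) ((r x - k) * inner_bump c d n x) = 0.
  move=> ac db; pose th := inner_bump c d n.
  pose l := (\int[mu]_(x in Om) th x) / (\int[mu]_(x in Om) th0 x).
  pose zeta x := th x + (- l) * th0 x.
  have bth : bmeas th by exact: bib.
  have bth0 : bmeas th0 by exact: bib.
  have sz : smooth zeta.
    by apply: smoothD; [|apply: smoothM; [exact: smooth_cst|]]; exact: smooth_bump.
  (* The smaller of the two margins, so that [[a + e, b - e]] contains both supports. *)
  pose e : R := (maxn n n0).+1%:R^-1.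
  have e0 : 0 < e by rewrite invr_gt0.
  have en : e <= n.+1%:R^-1 by rewrite lef_pV2 ?posrE// ler_nat ltnS leq_maxl.
  have en0 : e <= n0.+1%:R^-1 by rewrite lef_pV2 ?posrE// ler_nat ltnS leq_maxr.
  have [||x xab||phi tphi phiz] := @test_primitive zeta (a + e) (b - e) _ _ sz.
  - by rewrite ltrDl.
  - by rewrite gtrBl.
  - rewrite /zeta /th /th0 /inner_bump !bump_eq0 ?mulr0 ?addr0//;
    apply: contra xab; apply: subset_itv; rewrite bnd_simp lerD ?lerN2//.
  - rewrite /zeta RintegralD//; last 2 first.
    + exact: bmeas_leb.
    + by apply: bmeas_leb => //; exact: bmeasZ.
    rewrite RintegralZl//; last exact: bmeas_leb.
    by rewrite /l mulNr divfK// subrr.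
  have := r0 _ tphi; rewrite phiz.
  have -> : \int[mu]_(x in Om) (r x * zeta x) =
      \int[mu]_(x in Om) (r x * th x) - l * \int[mu]_(x in Om) (r x * th0 x).
    rewrite -RintegralZl//; last exact: integrable_leb_bmeasM.
    rewrite -RintegralB//; last 2 first.
    - exact: integrable_leb_bmeasM.
    - rewrite (_ : _ \o _ = (fun x => l%:E * (r x * th0 x)%:E)%E)//.
      by apply: (integrableZl (measurable_Omega a b) l (integrable_leb_bmeasM ir bth0)).
    by apply: eq_Rintegral => x _; rewrite /zeta; ring.
  move/eqP; rewrite subr_eq0 => /eqP E.
  have -> : \int[mu]_(x in Om) ((r x - k) * inner_bump c d n x) =
      \int[mu]_(x in Om) (r x * th x) - k * \int[mu]_(x in Om) th x.
    rewrite -RintegralZl//; last exact: bmeas_leb.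
    rewrite -RintegralB//; last 2 first.
    - exact: integrable_leb_bmeasM.
    - by apply: bmeas_leb => //; exact: bmeasZ.
    by apply: eq_Rintegral => x _; rewrite mulrBl.
  by rewrite E /l /k; field.
pose s x := r x - k.
have is_ : mu.-integrable Om (EFin \o s).
  exact: (integrableB (measurable_Omega a b) ir (bmeas_leb ab (bmeas_cst k))).
have H2 (c d : R) : a <= c -> d <= b -> (\int[mu]_(x in Om `&` `]c, d[) (s x)%:E = 0)%E.
  move=> ac db; have := @cvg_integral_inner_bump R a b mu s c d is_.
  have -> : (fun n => \int[mu]_(x in Om) (s x * inner_bump c d n x)%:E)%E = fun=> 0%E.
    apply/funext => n; rewrite -[LHS]fineK; last first.
      by apply: integrable_fin_num => //; exact: integrable_leb_bmeasM.
    by have := H1 c d n ac db; rewrite /Rintegral => ->.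
  by move=> /(cvg_unique _ (cvg_cst 0%E)) => /(_ (@ereal_hausdorff R)).
have isT : mu.-integrable [set: RR] (EFin \o (s \_ Om)).
  by rewrite -restrict_EFin; apply/(integrable_mkcond _ (measurable_Omega a b)).
have F0 x : \int[mu]_(t in `]-oo, x]) (s \_ Om) t = 0.
  rewrite -Rintegral_mkcondr.
  case: (leP b x) => [bx|xb].
    rewrite (_ : _ `&` _ = Om `&` `]a, b[); first by rewrite /Rintegral H2.
    rewrite setIid; apply/seteqP; split => y /=; first by case.
    by rewrite !in_itv/= => /andP[ay yb]; rewrite ay yb (le_trans (ltW yb) bx).
  rewrite (_ : _ `&` _ = `]a, x]%classic); last first.
    apply/seteqP; split => y /=; rewrite !in_itv/=; first by move=> [-> /andP[->]].
    by move=> /andP[-> yx]; rewrite yx (le_lt_trans yx xb).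
  have sub : `]a, x[ `<=` Om by apply: subset_itvl; rewrite bnd_simp ltW.
  have is2 : mu.-integrable `]a, x[ (EFin \o s).
    exact: (integrableS (measurable_Omega a b) _ sub is_).
  rewrite -Rintegral_itv_bndo_bndc//.
  rewrite (_ : `]a, x[%classic = Om `&` `]a, x[); first by rewrite /Rintegral H2// ltW.
  by rewrite setIidr.
(* Lebesgue differentiation: the restriction of [s] to [Om] is almost everywhere the derivative of
   its indefinite integral, which is 0 by [F0]. *)
have := @FTC1Ny R (s \_ Om) _ (open_integrable_locally openT isT).
have -> : (fun x => \int[mu]_(t in `]-oo, x]) (s \_ Om) t) = fun=> 0.
  by apply/funext.
move=> /(_ _); case; first by move=> y; exact: integrableS isT.
move=> N [mN N0 sub]; exists N; split => //; apply: subset_trans sub => x /=.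
apply: contra_not => -[_] + Ox.
rewrite derive1_cst patchE mem_set// => /esym/eqP; rewrite subr_eq0 => /eqP -> //.
Qed.

End DuBoisReymond.

(** * Representatives of bounded variation *)

Section Representation.
Context {R : realType} (a b : R).
Hypothesis ab : a < b.
Local Notation RR := (measurableTypeR R).
Local Notation mu := (@lebesgue_measure R).
Local Notation Om := (`]a, b[%classic : set R).
Local Notation fmeas := {finite_measure set RR -> \bar R}.
Implicit Types (p q : fmeas) (g h phi r : R -> R) (nu : {charge set RR -> \bar R}).

(* [pos_part] and [neg_part] with the finiteness that their types forget. *)
Definition posf nu : fmeas := jordan_pos (hahnP nu).
Definition negf nu : fmeas := jordan_neg (hahnP nu).

Lemma Rintegral_EFin p g : bmeas g ->
  (\int[p]_(x in Om) (g x)%:E = (\int[p]_(x in Om) g x)%:E)%E.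
Proof.
move=> bg; rewrite /Rintegral fineK//; apply: integrable_fin_num => //.
exact: bmeas_fin.
Qed.

Lemma charge_integralE nu g : bmeas g ->
  charge_integral nu Om g =
  (\int[posf nu]_(x in Om) g x - \int[negf nu]_(x in Om) g x)%:E.
Proof.
by move=> bg; rewrite EFinB -(Rintegral_EFin (posf nu))// -(Rintegral_EFin (negf nu)).
Qed.

Lemma jordanE nu (A : set RR) : measurable A -> (nu A = posf nu A - negf nu A)%E.
Proof.
by move=> mA; rewrite (jordan_decomp (hahnP nu) mA) /cadd/= cscaleN1.
Qed.

(* Moves the negative terms across, so that both sides become measures. *)
Lemma fin_num_subD_eq (x y z t : \bar R) : x \is a fin_num -> y \is a fin_num ->
  z \is a fin_num -> t \is a fin_num ->
  (x - y = z - t <-> x + t = y + z)%E.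
Proof.
move: x y z t => [x| |] [y| |] [z| |] [t| |]// _ _ _ _; split => -[H];
  congr EFin; lra.
Qed.

Lemma Rintegral_measure_add p q g : bmeas g ->
  \int[measure_add p q]_(x in Om) g x =
  \int[p]_(x in Om) g x + \int[q]_(x in Om) g x.
Proof.
move=> bg; have [mg _] := bg; apply: EFin_inj.
rewrite EFinD -!Rintegral_EFin// integral_measure_add//; exact: bmeas_fin.
Qed.

(** The pair [(p, q)] may differ from the Jordan decomposition. The positive measures [posf nu + q]
    and [negf nu + p] agree inside [Om], which avoids subtracting measures. *)
Lemma Rintegral_jordan nu p q g :
  (forall A : set RR, measurable A -> A `<=` Om -> nu A = p A - q A)%E ->
  bmeas g ->
  \int[posf nu]_(x in Om) g x - \int[negf nu]_(x in Om) g x =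
  \int[p]_(x in Om) g x - \int[q]_(x in Om) g x.
Proof.
move=> nupq bg.
suff : \int[measure_add (posf nu) q]_(x in Om) g x =
    \int[measure_add (negf nu) p]_(x in Om) g x.
  by rewrite !Rintegral_measure_add// => H; apply/eqP; rewrite subr_eq; apply/eqP; lra.
congr fine; apply: eq_measure_integral => A mA AO.
apply: (etrans (measure_addE _ _ _)); apply/esym.
apply: (etrans (measure_addE _ _ _)); apply/esym.
have := nupq A mA AO; rewrite jordanE//.
by move/(fin_num_subD_eq _ _ _ _); apply; exact: fin_num_measure.
Qed.

(** The right-continuous representative with derivative [p - q] on [Om]. Mutual singularity is not
    imposed, so a competitor arises by adding mass to either measure. *)
Definition bv_repr (k : R) p q (x : R) := k + cumul a p x - cumul a q x.

Lemma bmeas_repr k p q : bmeas (bv_repr k p q).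
Proof.
by apply: bmeasB; [apply: bmeasD; [exact: bmeas_cst|]|]; exact: bmeas_cumul.
Qed.

(** Mean zero of [g] removes the contribution of [k], which is the boundary term at [a]. *)
Lemma fubini_repr k p q g : bmeas g -> \int[mu]_(x in Om) g x = 0 ->
  \int[mu]_(x in Om) (bv_repr k p q x * g x) =
  \int[p]_(x in Om) tailint a b g x - \int[q]_(x in Om) tailint a b g x.
Proof.
move=> bg g0.
have bp := bmeasM (bmeas_cumul a p) bg; have bq := bmeasM (bmeas_cumul a q) bg.
have bk := bmeasZ k bg.
rewrite -!fubini_cumul//.
transitivity (\int[mu]_(x in Om) (k * g x + cumul a p x * g x - cumul a q x * g x)).
  by apply: eq_Rintegral => x _; rewrite /bv_repr; ring.
rewrite RintegralB//; [|by apply: bmeas_leb => //; exact: bmeasD|exact: bmeas_leb].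
rewrite RintegralD//; [|exact: bmeas_leb..].
by rewrite RintegralZl ?g0 ?mulr0 ?add0r//; exact: bmeas_leb.
Qed.

Lemma fubini_repr_test k p q phi : test_function a b phi ->
  \int[mu]_(x in Om) (bv_repr k p q x * derive1 phi x) =
  - (\int[p]_(x in Om) phi x - \int[q]_(x in Om) phi x).
Proof.
move=> tphi; rewrite fubini_repr; last 2 first.
- exact: (bmeas_test_derive ab tphi).
- exact: (Rintegral_test_derive ab tphi).
have E (m : fmeas) : \int[m]_(x in Om) tailint a b (derive1 phi) x =
    - \int[m]_(x in Om) phi x.
  rewrite -mulN1r -RintegralZl//; last by apply: bmeas_fin; exact: (bmeas_test ab tphi).
  apply: eq_Rintegral => x; rewrite inE => Ox.
  by rewrite (tailint_test ab tphi Ox) mulN1r.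
by rewrite !E; ring.
Qed.

Lemma repr_derivative k p q nu :
  (forall A : set RR, measurable A -> nu A = nu (A `&` Om)) ->
  (forall A : set RR, measurable A -> A `<=` Om -> nu A = p A - q A)%E ->
  is_distributional_derivative a b (bv_repr k p q) nu.
Proof.
move=> nuO nupq; split=> // phi tphi; have bphi := bmeas_test ab tphi.
have bd := bmeas_test_derive ab tphi.
rewrite charge_integralE// (Rintegral_jordan nupq bphi) -EFinN.
rewrite -(fubini_repr_test k)// /Rintegral fineK//.
apply: integrable_fin_num => //; apply: bmeas_leb => //.
by apply: bmeasM => //; exact: bmeas_repr.
Qed.

(** [D] picks its charge by choice; this determines it on [Om], whichever charge was picked. *)
Lemma repr_derivative_unique k p q nu :
  is_distributional_derivative a b (bv_repr k p q) nu ->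
  forall A : set RR, measurable A -> A `<=` Om -> (nu A = p A - q A)%E.
Proof.
move=> [_ dd] A mA AO.
have : measure_add (posf nu) q A = measure_add (negf nu) p A.
  apply: (fmeas_test_eq (a := a) (b := b)) mA AO => phi tphi.
  have bphi := bmeas_test ab tphi.
  rewrite !Rintegral_EFin// !Rintegral_measure_add//.
  have := dd _ tphi; rewrite charge_integralE//.
  move=> /(congr1 fine); rewrite [LHS](fubini_repr_test k)//= => H; congr EFin.
  by lra.
move=> E; have := etrans (esym (measure_addE _ _ A)) (etrans E (measure_addE _ _ A)).
rewrite jordanE//.
by move/(fin_num_subD_eq _ _ _ _); apply; exact: fin_num_measure.
Qed.

(** Subtracting the representative built from the Jordan decomposition leaves a function with zero
    distributional derivative. *)
Lemma derivative_repr r nu : mu.-integrable Om (EFin \o r) ->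
  is_distributional_derivative a b r nu ->
  exists k, ae_eq mu Om (EFin \o r) (EFin \o bv_repr k (posf nu) (negf nu)).
Proof.
move=> ir [_ dd]; pose w := bv_repr 0 (posf nu) (negf nu).
have bw : bmeas w by exact: bmeas_repr.
have irw : mu.-integrable Om (EFin \o (fun x => r x - w x)).
  exact: (integrableB (measurable_Omega a b) ir (bmeas_leb ab bw)).
have [phi tphi|k H] := dubois_reymond ab irw.
  have bd := bmeas_test_derive ab tphi; have bphi := bmeas_test ab tphi.
  transitivity (\int[mu]_(x in Om) (r x * derive1 phi x - w x * derive1 phi x)).
    by apply: eq_Rintegral => x _; rewrite mulrBl.
  rewrite RintegralB//; last 2 first.
  - exact: integrable_leb_bmeasM.
  - by apply: bmeas_leb => //; exact: bmeasM.
  rewrite fubini_repr_test// {1}/Rintegral dd// charge_integralE//=.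
  by rewrite subrr.
exists k; apply: filterS H => x /= H Ox.
have [] := H Ox; rewrite /w /bv_repr => /eqP E; congr EFin; lra.
Qed.

End Representation.

(** * Competitors in the minimisation problem *)

Section Competitors.
Context {R : realType} (a b : R).
Hypothesis ab : a < b.
Local Notation RR := (measurableTypeR R).
Local Notation mu := (@lebesgue_measure R).
Local Notation Om := (`]a, b[%classic : set R).
Local Notation fmeas := {finite_measure set RR -> \bar R}.
Implicit Types (p q : fmeas) (g h phi r : R -> R) (nu : {charge set RR -> \bar R}).

(** Minimality of the Jordan decomposition: on the positive Hahn set the charge is at most [p], on
    the negative one its opposite is at most [q]. *)
Lemma jordan_le nu p q :
  (forall A : set RR, measurable A -> A `<=` Om -> nu A = p A - q A)%E ->
  forall A : set RR, measurable A -> A `<=` Om ->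
  (posf nu A <= p A)%E /\ (negf nu A <= q A)%E.
Proof.
move=> nupq A mA AO; have [[mP _] [mN _] _ _] := hahnP nu; split.
  have -> : posf nu A = nu (A `&` hahn_pos nu).
    rewrite -[LHS]/(jordan_pos (hahnP nu) A) jordan_posE cjordan_posE /crestr0/=.
    by rewrite mem_set.
  rewrite nupq; [|exact: measurableI|by move=> x [/AO]].
  apply: (@le_trans _ _ (p (A `&` hahn_pos nu))).
    by rewrite leeBlDr ?fin_num_measure ?leeDl//; exact: measurableI.
  by apply: le_measure; rewrite ?inE//; exact: measurableI.
have -> : negf nu A = (- nu (A `&` hahn_neg nu))%E.
  rewrite -[LHS]/(jordan_neg (hahnP nu) A) jordan_negE cjordan_negE /crestr0/=.
  by rewrite mem_set.
rewrite nupq; [|exact: measurableI|by move=> x [/AO]].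
have mI : measurable (A `&` hahn_neg nu) by exact: measurableI.
rewrite fin_num_oppeB ?fin_num_measure//.
apply: (@le_trans _ _ (q (A `&` hahn_neg nu))).
  by rewrite addeC leeBlDr ?fin_num_measure ?leeDl.
by apply: le_measure; rewrite ?inE.
Qed.

Lemma le_Rintegral_measure p q g : bmeas g -> (forall x, 0 <= g x) ->
  (forall A : set RR, measurable A -> A `<=` Om -> p A <= q A)%E ->
  \int[p]_(x in Om) g x <= \int[q]_(x in Om) g x.
Proof.
move=> bg g0 pq; rewrite -lee_fin -!Rintegral_EFin//.
have E (m : fmeas) : (\int[m]_(x in Om) (g x)%:E =
    \int[mrestr m (measurable_Omega a b)]_(x in Om) (g x)%:E)%E.
  by apply: eq_measure_integral => A mA AO; rewrite /= /mrestr setIidl.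
rewrite (E p) (E q); apply: ge0_le_measure_integral => //.
- by move=> A mA; rewrite /mrestr; apply: pq; [exact: measurableI|exact: subIsetr].
- by case: bg => mg _; exact/measurable_EFinP.
Qed.

Lemma integral_tv nu g : bmeas g ->
  (\int[tv_measure nu]_(x in Om) (g x)%:E =
   (\int[posf nu]_(x in Om) g x + \int[negf nu]_(x in Om) g x)%:E)%E.
Proof.
move=> bg; rewrite -Rintegral_measure_add// -Rintegral_EFin//.
by apply: eq_measure_integral => A mA AO; exact/esym/measure_addE.
Qed.

Let diff_restr p q : {charge set RR -> \bar R} :=
  cadd (charge_of_finite_measure (mrestr p (measurable_Omega a b)))
       (copp (charge_of_finite_measure (mrestr q (measurable_Omega a b)))).

Let dd_diff_restr k p q :
  is_distributional_derivative a b (bv_repr a k p q) (diff_restr p q).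
Proof.
have E (A : set RR) : diff_restr p q A = (p (A `&` Om) - q (A `&` Om))%E by [].
apply: repr_derivative => // A mA; rewrite !E; first by rewrite -setIA setIid.
by move=> AO; rewrite setIidl.
Qed.

Definition reprBV k p q : BV a b :=
  MkBV (bmeas_leb ab (bmeas_repr a k p q)) (ex_intro _ _ (dd_diff_restr k p q)).

Lemma D_reprBV k p q (A : set RR) : measurable A -> A `<=` Om ->
  (D (reprBV k p q) A = p A - q A)%E.
Proof.
move=> mA AO; apply: (@repr_derivative_unique _ a b ab k) => //.
by rewrite /D; case: cid.
Qed.

Lemma BV_repr (u : BV a b) : exists k,
  ae_eq mu Om (EFin \o u) (EFin \o bv_repr a k (posf (D u)) (negf (D u))).
Proof.
apply: derivative_repr => //; first exact: BV_integrable.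
by rewrite /D; case: cid.
Qed.

Lemma integral_sqr_ae (f1 f2 : BV a b) g1 g2 : bmeas g1 -> bmeas g2 ->
  ae_eq mu Om (EFin \o f1) (EFin \o g1) ->
  ae_eq mu Om (EFin \o f2) (EFin \o g2) ->
  (\int[mu]_(x in Om) ((f1 x - f2 x) ^+ 2)%:E =
   (\int[mu]_(x in Om) ((g1 x - g2 x) ^+ 2))%:E)%E.
Proof.
move=> bg1 bg2 e1 e2.
have bB := bmeasB bg1 bg2; have bB2 := bmeasM bB bB.
have mf (f : BV a b) : measurable_fun (Om : set RR) f.
  by apply/measurable_EFinP; apply: measurable_int (BV_integrable f).
rewrite [in RHS]/Rintegral fineK; last first.
  by apply: integrable_fin_num => //; exact: (bmeas_leb ab bB2).
apply: ae_eq_integral => //.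
- apply/measurable_EFinP; apply: measurable_funX.
  by apply: measurable_funB; exact: mf.
- by have [m _] := bB2; apply/measurable_EFinP/measurable_funTS.
- apply: filterS2 e1 e2 => x /= e1 e2 Ox.
  by have [->] := e1 Ox; have [->] := e2 Ox.
Qed.

(** Reduces the problem to a real inequality over triples [(k, p, q)]. The left side is the exact
    energy of [u]; the right side only dominates that of the competitor, by [jordan_le]. *)
Lemma minimizer_repr (alpha g : R -> R) (f u : BV a b) :
  bmeas g -> (forall x, 0 <= g x) -> (forall x, Om x -> alpha x = g x) ->
  is_minimizer alpha f u ->
  exists ku kf,
    let U := bv_repr a ku (posf (D u)) (negf (D u)) in
    let F := bv_repr a kf (posf (D f)) (negf (D f)) in
    forall k p q,
    2^-1 * (\int[mu]_(x in Om) ((F x - U x) ^+ 2)) +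
      (\int[posf (D u)]_(x in Om) g x + \int[negf (D u)]_(x in Om) g x) <=
    2^-1 * (\int[mu]_(x in Om) ((F x - bv_repr a k p q x) ^+ 2)) +
      (\int[p]_(x in Om) g x + \int[q]_(x in Om) g x).
Proof.
move=> bg g0 ag umin; have [ku Hu] := BV_repr u; have [kf Hf] := BV_repr f.
exists ku, kf => U F k p q.
have tvE (v : BV a b) : (\int[tv_measure (D v)]_(x in Om) (alpha x)%:E =
    (\int[posf (D v)]_(x in Om) g x + \int[negf (D v)]_(x in Om) g x)%:E)%E.
  rewrite -integral_tv//; apply: eq_integral => x; rewrite inE => Ox.
  by rewrite ag.
have := umin (reprBV k p q); rewrite /weighted_TV_energy !tvE.
have bU := bmeas_repr a ku (posf (D u)) (negf (D u)).
have bF := bmeas_repr a kf (posf (D f)) (negf (D f)).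
have bV := bmeas_repr a k p q.
have HV : ae_eq mu Om (EFin \o reprBV k p q) (EFin \o bv_repr a k p q) by exact: aeW.
rewrite (integral_sqr_ae bF bU Hf Hu) (integral_sqr_ae bF bV Hf HV).
rewrite -!EFinM -!EFinD lee_fin => /le_trans; apply; rewrite lerD2l.
have le A := @jordan_le (D (reprBV k p q)) p q (@D_reprBV k p q) A.
by apply: lerD; apply: le_Rintegral_measure => // A mA AO; have [] := le A mA AO.
Qed.

End Competitors.

(** * The regularised sign *)

Section Ramp.
Context {R : realFieldType} (c : R).
Hypothesis c0 : 0 < c.

Definition sqr_pos (s : R) := Num.max s 0 ^+ 2.

(* The second derivative of [c ^ 2 * ramp] is 2 on ]-c, 0[, -2 on ]0, c[ and 0
   elsewhere, and [ramp] is -1 before -c and 1 after c. *)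
Definition ramp (s : R) :=
  c ^- 2 * (sqr_pos (s + c) - 2 * sqr_pos s + sqr_pos (s - c)) - 1.

Definition ramp' (s : R) :=
  2 * c ^- 2 * (Num.max (s + c) 0 - 2 * Num.max s 0 + Num.max (s - c) 0).

(** Differentiability is recorded as a quadratic Taylor bound, the form that [tailint_chain]
    consumes. *)
Lemma sqr_pos_taylor (s r : R) :
  `|sqr_pos s - sqr_pos r - 2 * Num.max r 0 * (s - r)| <= (s - r) ^+ 2.
Proof.
have h1 := sqr_ge0 (s - r); have h2 := sqr_ge0 s; have h3 := sqr_ge0 r.
by rewrite /sqr_pos; case: (leP s 0) => s0; case: (leP r 0) => r0;
  rewrite ler_norml; apply/andP; split; nra.
Qed.

Lemma max0_lip (s r : R) : `|Num.max s 0 - Num.max r 0| <= `|s - r|.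
Proof.
by case: (leP s 0) => s0; case: (leP r 0) => r0;
  rewrite ler_norml; apply/andP; split; case: (ger0P (s - r)) => sr; lra.
Qed.

Let c2 : 0 < c ^- 2. Proof. by rewrite invr_gt0 exprn_gt0. Qed.

(** The 4 is [1 + 2 + 1], from the coefficients of the three squares; the 8 in [ramp'_lip] is twice
    that, from the factor 2 in [ramp']. *)
Lemma ramp_taylor (s r : R) :
  `|ramp s - ramp r - ramp' r * (s - r)| <= 4 * c ^- 2 * (s - r) ^+ 2.
Proof.
have h1 := sqr_pos_taylor (s + c) (r + c).
have h2 := sqr_pos_taylor s r.
have h3 := sqr_pos_taylor (s - c) (r - c).
have e1 : s + c - (r + c) = s - r by ring.
have e3 : s - c - (r - c) = s - r by ring.
rewrite e1 in h1; rewrite e3 in h3; rewrite /ramp /ramp'.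
move: (sqr_pos (s + c)) (sqr_pos (r + c)) (sqr_pos s) (sqr_pos r)
  (sqr_pos (s - c)) (sqr_pos (r - c)) h1 h2 h3 => A1 B1 A2 B2 A3 B3.
move: (Num.max (r + c) 0) (Num.max r 0) (Num.max (r - c) 0) => M1 M2 M3.
set d := s - r => h1 h2 h3.
rewrite (_ : _ - _ - _ = c ^- 2 * ((A1 - B1 - 2 * M1 * d) -
  2 * (A2 - B2 - 2 * M2 * d) + (A3 - B3 - 2 * M3 * d))); last by ring.
rewrite normrM (gtr0_norm c2).
rewrite (_ : 4 * c ^- 2 * d ^+ 2 = c ^- 2 * (4 * d ^+ 2)); last by ring.
rewrite ler_wpM2l ?(ltW c2)//.
rewrite (le_trans (ler_normD _ _))//.
rewrite (le_trans (lerD (ler_normB _ _) (lexx _)))//.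
rewrite normrM (ger0_norm (_ : 0 <= 2 :> R))//; lra.
Qed.

Lemma ramp'_lip (s r : R) : `|ramp' s - ramp' r| <= 8 * c ^- 2 * `|s - r|.
Proof.
have h1 := max0_lip (s + c) (r + c).
have h2 := max0_lip s r.
have h3 := max0_lip (s - c) (r - c).
have e1 : s + c - (r + c) = s - r by ring.
have e3 : s - c - (r - c) = s - r by ring.
rewrite e1 in h1; rewrite e3 in h3; rewrite /ramp'.
move: (Num.max (r + c) 0) (Num.max r 0) (Num.max (r - c) 0) h1 h2 h3 => M1 M2 M3.
move: (Num.max (s + c) 0) (Num.max s 0) (Num.max (s - c) 0) => N1 N2 N3 h1 h2 h3.
rewrite (_ : _ - _ = c ^- 2 * (2 * ((N1 - M1) - 2 * (N2 - M2) + (N3 - M3))));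
  last by ring.
rewrite normrM (gtr0_norm c2).
rewrite (_ : 8 * c ^- 2 * `|s - r| = c ^- 2 * (8 * `|s - r|)); last by ring.
rewrite ler_wpM2l ?(ltW c2)//.
rewrite normrM (ger0_norm (_ : 0 <= 2 :> R))//.
have : `|N1 - M1 - 2 * (N2 - M2) + (N3 - M3)| <= `|s - r| + 2 * `|s - r| + `|s - r|.
  rewrite (le_trans (ler_normD _ _))// lerD//.
  rewrite (le_trans (ler_normB _ _))// lerD//.
  by rewrite normrM (ger0_norm (_ : 0 <= 2 :> R))// ler_wpM2l.
lra.
Qed.

Lemma ramp'_ge0 (s : R) : 0 <= ramp' s.
Proof.
rewrite /ramp' mulr_ge0// ?mulr_ge0 ?(ltW c2)//.
by case: (leP s 0) => ?; case: (leP (s + c) 0) => ?; case: (leP (s - c) 0) => ?; lra.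
Qed.

Lemma ramp0 : ramp 0 = 0.
Proof.
rewrite /ramp /sqr_pos !add0r; rewrite (max_l (ltW c0)) maxxx.
by rewrite max_r ?oppr_le0 ?(ltW c0)//; field; rewrite gt_eqF.
Qed.

Let rampE (s : R) : c ^+ 2 * ramp s =
  sqr_pos (s + c) - 2 * sqr_pos s + sqr_pos (s - c) - c ^+ 2.
Proof. by rewrite /ramp mulrBr mulr1 mulrA mulfV ?mul1r// expf_neq0// gt_eqF. Qed.

Let c2' : 0 < c ^+ 2. Proof. by rewrite exprn_gt0. Qed.

Lemma ramp_le1 (s : R) : `|ramp s| <= 1.
Proof.
suff : `|c ^+ 2 * ramp s| <= c ^+ 2 * 1 by rewrite normrM gtr0_norm// ler_pM2l.
(* [lra] and [nra] ignore section hypotheses, hence the copy of [c0]. *)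
have c0' := c0; have h1 := sqr_ge0 s.
have h2 := sqr_ge0 (s + c); have h3 := sqr_ge0 (s - c).
rewrite rampE /sqr_pos mulr1 ler_norml.
by case: (leP s 0) => ?; case: (leP (s + c) 0) => ?; case: (leP (s - c) 0) => ?;
  apply/andP; split; nra.
Qed.

(** [2 / c] is the largest slope of [ramp], attained at 0, and [ramp] is -1 at [- m] because
    [c <= m]. The mirror image [ramp_upper] starts from the value 1 at [m]. *)
Lemma ramp_lower (s m : R) : c <= m -> - m <= s -> 1 + ramp s <= 2 / c * (s + m).
Proof.
move=> cm ms; rewrite -(ler_pM2l c2') mulrDr rampE.
rewrite (_ : c ^+ 2 * (2 / c * _) = 2 * c * (s + m)); last by field; rewrite gt_eqF.
have h1 : 0 <= c * (m - c) by rewrite mulr_ge0 ?subr_ge0// ltW.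
have h2 : 0 <= c * (s + m) by rewrite mulr_ge0 ?(ltW c0)// -lerBlDr sub0r.
have c0' := c0; have h3 := sqr_ge0 s; have h4 := sqr_ge0 (s + c).
rewrite /sqr_pos.
by case: (leP s 0) => ?; case: (leP (s + c) 0) => ?; case: (leP (s - c) 0) => ?; nra.
Qed.

Lemma ramp_upper (s m : R) : c <= m -> s <= m -> 1 - ramp s <= 2 / c * (m - s).
Proof.
move=> cm ms; rewrite -(ler_pM2l c2') mulrBr rampE.
rewrite (_ : c ^+ 2 * (2 / c * _) = 2 * c * (m - s)); last by field; rewrite gt_eqF.
have h1 : 0 <= c * (m - c) by rewrite mulr_ge0 ?subr_ge0// ltW.
have h2 : 0 <= c * (m - s) by rewrite mulr_ge0 ?subr_ge0// ltW.
have c0' := c0; have h3 := sqr_ge0 s; have h4 := sqr_ge0 (s - c).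
rewrite /sqr_pos.
by case: (leP s 0) => ?; case: (leP (s + c) 0) => ?; case: (leP (s - c) 0) => ?; nra.
Qed.

End Ramp.

(** * Optimality conditions *)

Section Chain.
Context {R : realType} (a b : R).
Hypothesis ab : a < b.
Local Notation RR := (measurableTypeR R).
Local Notation mu := (@lebesgue_measure R).
Local Notation Om := (`]a, b[%classic : set R).
Local Notation fmeas := {finite_measure set RR -> \bar R}.
Implicit Types (p q : fmeas) (g h w : R -> R).

Lemma tailintM (k : R) g (y : R) : bmeas g ->
  tailint a b (fun x => k * g x) y = k * tailint a b g y.
Proof.
move=> bg; rewrite /tailint RintegralZl//; first exact: measurableI.
apply: bmeas_integrable => //; first exact: measurableI.
apply: le_lt_trans (lebesgue_Omega_fin ab); apply: le_measure; rewrite ?inE//.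
exact: measurableI.
Qed.

Lemma tailintB g h (y : R) : bmeas g -> bmeas h ->
  tailint a b (fun x => g x - h x) y = tailint a b g y - tailint a b h y.
Proof.
move=> bg bh; have mI : measurable (Om `&` `[y, +oo[ : set RR) by exact: measurableI.
have fI : (mu (Om `&` `[y, +oo[) < +oo)%E.
  by apply: le_lt_trans (lebesgue_Omega_fin ab); apply: le_measure; rewrite ?inE.
by rewrite /tailint RintegralB//; exact: bmeas_integrable.
Qed.

(* No regularity of [w] is available, so the chain rule is obtained by showing
   that the difference [H] of the two sides satisfies [|H z - H x| <= C |z - x|^2]. *)
Lemma tailint_chain w (e e' : R -> R) (K : R) : bmeas w ->
  (forall s r, `|e s - e r - e' r * (s - r)| <= K * (s - r) ^+ 2) ->
  (forall s r, `|e' s - e' r| <= K * `|s - r|) ->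
  e 0 = 0 ->
  forall y, e (tailint a b w y) = tailint a b (fun x => e' (tailint a b w x) * w x) y.
Proof.
move=> bw taylor lip e00 y.
have [mw [M wM]] := bw; have M_ge0 : 0 <= M by exact: le_trans (wM 0).
have K0 : 0 <= K by have := lip 1 0; rewrite subr0 normr1 mulr1; exact: le_trans.
pose Z := tailint a b w; pose g x := e' (Z x) * w x.
have be : bmeas (fun x => e' (Z x)).
  by apply: bmeas_lipschitz_comp lip; exact: bmeas_tailint.
have bg : bmeas g by exact: bmeasM.
pose H x := e (Z x) - tailint a b g x.
have lipZ := tailint_lip ab mw wM.
(* [K] comes from the Lipschitz bound on [e'], one [M] from that on [Z], the other from the size of
   [w]. *)
pose C := K * M * M; have C0 : 0 <= C by rewrite !mulr_ge0.
have H2 x z : `|e' (Z x) * (Z z - Z x) - (tailint a b g z - tailint a b g x)| <=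
    C * (z - x) ^+ 2.
  (* With the coefficient frozen at [x], [k] is of order [|z - x|] between [x] and [z]; integrating
     over that length gives the square. *)
  pose k t := e' (Z x) * w t - g t.
  have bk : bmeas k by apply: bmeasB => //; exact: bmeasZ.
  rewrite (_ : _ - _ = tailint a b k z - tailint a b k x); last first.
    by rewrite /k !tailintB ?tailintM//; [rewrite -/Z; ring|exact: bmeasZ..].
  have bound t : `|t - x| <= `|z - x| -> `|k t| <= C * `|z - x|.
    move=> tz; rewrite /k /g -mulrBl normrM /C mulrAC ler_pM// (le_trans (lip _ _))//.
    rewrite -mulrA ler_wpM2l// (le_trans (lipZ _ _))// ler_wpM2l//.
    by rewrite distrC.
  have Cz : 0 <= C * `|z - x| by rewrite mulr_ge0.
  rewrite -[(z - x) ^+ 2]real_normK ?num_real// expr2 mulrA.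
  case: (leP x z) => xz.
    have nz : `|z - x| = z - x by rewrite ger0_norm ?subr_ge0.
    rewrite distrC [X in _ <= _ * X]nz.
    apply: (tailint_dist ab) => // t xt tz; apply: bound.
    by rewrite nz ger0_norm ?subr_ge0// lerD2r ltW.
  have nz : `|z - x| = x - z by rewrite ltr0_norm ?subr_lt0 ?opprB.
  rewrite [X in _ <= _ * X]nz.
  apply: (tailint_dist ab) => //; first exact: ltW.
  move=> t zt tx; apply: bound.
  by rewrite nz ltr0_norm ?subr_lt0// opprB lerB.
have Hq x z : `|H z - H x| <= (K * M ^+ 2 + C) * (z - x) ^+ 2.
  rewrite (_ : H z - H x = (e (Z z) - e (Z x) - e' (Z x) * (Z z - Z x)) +
    (e' (Z x) * (Z z - Z x) - (tailint a b g z - tailint a b g x))); last first.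
    by rewrite /H; ring.
  rewrite (le_trans (ler_normD _ _))// mulrDl lerD//.
  rewrite (le_trans (taylor _ _))// -mulrA ler_wpM2l//.
  rewrite -exprMn -[leLHS]real_normK ?num_real// -[leRHS]real_normK ?num_real//.
  by rewrite ler_pXn2r// ?nnegrE// normrM (ger0_norm M_ge0).
(* [H] has derivative 0 everywhere, and both its terms vanish at [b]. *)
have : H y = H b.
  by apply: is_derive_0_is_cst => x; apply: quadratic_is_derive0 => z; exact: Hq.
rewrite /H /Z !(tailint_ge _ _ (lexx b)) e00 subrr => /eqP.
by rewrite subr_eq0 => /eqP.
Qed.

End Chain.

Section MeasureOps.
Context {R : realType} (a b : R).
Local Notation RR := (measurableTypeR R).
Local Notation Om := (`]a, b[%classic : set R).
Local Notation fmeas := {finite_measure set RR -> \bar R}.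
Implicit Types (p q : fmeas) (g : R -> R) (t : {nonneg R}).

Lemma cumul_add p q (x : R) : cumul a (measure_add p q) x = cumul a p x + cumul a q x.
Proof.
rewrite /cumul -fineD ?fin_num_measure//; congr fine; exact: measure_addE.
Qed.

Lemma cumul_mscale t p (x : R) : cumul a (mscale t p) x = t%:num * cumul a p x.
Proof. by rewrite /cumul /mscale/= fineM// fin_num_measure. Qed.

(** Turns the competitors [u +- t 1_[y,b[] into a change of [p] or of [q] alone. *)
Lemma cumul_dirac (y x : R) : Om y ->
  cumul a (\d_(y : RR)) x = \1_(`[y, +oo[%classic) x.
Proof.
rewrite /= in_itv/= => /andP[ay _].
by rewrite /cumul/= /dirac/= !indicE !mem_setE !in_itv/= ay andbT; case: (y <= x).
Qed.

Lemma Rintegral_mscale t p g : bmeas g -> (forall x, Om x -> 0 <= g x) ->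
  \int[mscale t p]_(x in Om) g x = t%:num * \int[p]_(x in Om) g x.
Proof.
move=> bg g0; have [mg _] := bg; rewrite /Rintegral ge0_integral_mscale//.
- rewrite fineM//; apply: integrable_fin_num => //; exact: bmeas_fin.
- by apply/measurable_EFinP/measurable_funTS.
Qed.

Lemma Rintegral_dirac (y : R) g : bmeas g -> Om y ->
  \int[\d_(y : RR)]_(x in Om) g x = g y.
Proof.
move=> [mg _] Oy; rewrite /Rintegral integral_dirac//.
  by rewrite diracE mem_set// mul1e.
by apply/measurable_EFinP/measurable_funTS.
Qed.

End MeasureOps.

(** * First variations of the energy and comparison of masses *)

Section Variation.
Context {R : realType} (a b : R).
Hypothesis ab : a < b.
Local Notation RR := (measurableTypeR R).
Local Notation mu := (@lebesgue_measure R).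
Local Notation Om := (`]a, b[%classic : set R).
Local Notation fmeas := {finite_measure set RR -> \bar R}.
Implicit Types (g h w : R -> R).

Lemma ge0_of_quadratic (A B : R) :
  (forall t, 0 < t -> t <= 1 -> 0 <= t * A + t ^+ 2 * B) -> 0 <= A.
Proof.
move=> AB; apply/ler_addgt0Pr => e e0.
(* Small enough that [t * |B| <= e], and at most 1 as the hypothesis on [A] and [B] demands. *)
pose t := Num.min 1 (e / (`|B| + 1)).
have t0 : 0 < t by rewrite lt_min ltr01 divr_gt0// ltr_wpDl.
have t1 : t <= 1 by rewrite ge_min lexx.
have := AB _ t0 t1; rewrite expr2 -mulrA -mulrDr pmulr_rge0// => /le_trans; apply.
rewrite lerD2l (le_trans (ler_norm _))// normrM (gtr0_norm t0).
have te : t <= e / (`|B| + 1) by rewrite ge_min lexx orbT.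
rewrite (le_trans (ler_wpM2r _ te))// -mulrA ger_pMr//.
by rewrite ler_pdivrMl ?ltr_wpDl// mulr1 lerDl.
Qed.

Variables (k kf : R) (p q pf qf : fmeas) (al : R -> R) (c : R).
Hypotheses (bal : bmeas al) (c0 : 0 < c) (alc : forall x, Om x -> c <= al x).
Let U := bv_repr a k p q.
Let F := bv_repr a kf pf qf.
Hypothesis minU : forall k' p' q',
  2^-1 * (\int[mu]_(x in Om) ((F x - U x) ^+ 2)) +
    (\int[p]_(x in Om) al x + \int[q]_(x in Om) al x) <=
  2^-1 * (\int[mu]_(x in Om) ((F x - bv_repr a k' p' q' x) ^+ 2)) +
    (\int[p']_(x in Om) al x + \int[q']_(x in Om) al x).

Let bU : bmeas U. Proof. exact: bmeas_repr. Qed.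
Let bF : bmeas F. Proof. exact: bmeas_repr. Qed.
Let w x := U x - F x.
Let bw : bmeas w. Proof. exact: bmeasB. Qed.
Let Z := tailint a b w.

(** The variation term is not differentiable, so only its one-sided growth [t * C] is bounded; the
    fidelity term contributes [int w h]. The range [t <= 1] admits the factor [1 - t] of
    [slackness]. *)
Let first_variation h (C : R) : bmeas h ->
  (forall t, 0 < t -> t <= 1 -> exists k' p' q',
    (forall x, Om x -> bv_repr a k' p' q' x = U x + t * h x) /\
    \int[p']_(x in Om) al x + \int[q']_(x in Om) al x <=
    \int[p]_(x in Om) al x + \int[q]_(x in Om) al x + t * C) ->
  0 <= \int[mu]_(x in Om) (w x * h x) + C.
Proof.
move=> bh H; apply: (@ge0_of_quadratic _ (2^-1 * \int[mu]_(x in Om) (h x * h x))).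
move=> t t0 t1; have [k' [p' [q' [E le]]]] := H t t0 t1.
have := le_trans (minU k' p' q') (lerD (lexx _) le).
have bwh := bmeasM bw bh; have bhh := bmeasM bh bh; have bww := bmeasM bw bw.
have -> : \int[mu]_(x in Om) ((F x - U x) ^+ 2) = \int[mu]_(x in Om) (w x * w x).
  by apply: eq_Rintegral => x _; rewrite /w; ring.
have -> : \int[mu]_(x in Om) ((F x - bv_repr a k' p' q' x) ^+ 2) =
    \int[mu]_(x in Om) (w x * w x) + 2 * t * (\int[mu]_(x in Om) (w x * h x)) +
    t ^+ 2 * (\int[mu]_(x in Om) (h x * h x)).
  have b2 := bmeasZ (2 * t) bwh; have b3 := bmeasZ (t ^+ 2) bhh.
  rewrite -RintegralZl//; last exact: bmeas_leb.
  rewrite -RintegralZl//; last exact: bmeas_leb.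
  rewrite -RintegralD//; [|exact: (bmeas_leb ab bww)|exact: (bmeas_leb ab b2)].
  rewrite -RintegralD//; last 2 first.
  - exact: (bmeas_leb ab (bmeasD bww b2)).
  - exact: (bmeas_leb ab b3).
  by apply: eq_Rintegral => x; rewrite inE => Ox; rewrite E// /w; ring.
lra.
Qed.

Let al_ge0 x : Om x -> 0 <= al x.
Proof. by move=> Ox; rewrite (le_trans (ltW c0))// alc. Qed.

Let tailint_indic y : Z y = \int[mu]_(x in Om) (w x * \1_(`[y, +oo[%classic) x).
Proof.
rewrite /Z /tailint Rintegral_mkcondr; apply: eq_Rintegral => x _.
by rewrite patchE indicE; case: ifP => _; rewrite ?mulr1 ?mulr0.
Qed.

Let bstep y : bmeas (\1_(`[y, +oo[%classic) : R -> R).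
Proof. exact: bmeas_indic. Qed.

(** A jump may be placed at any point, so the bound holds everywhere in [Om]; this matters because
    [p] and [q] may be singular. *)
Lemma tailint_lower y : Om y -> 0 <= al y + Z y.
Proof.
move=> Oy; rewrite addrC tailint_indic; apply: first_variation => // t t0 t1.
pose tn : {nonneg R} := NngNum (ltW t0).
exists k, (measure_add p (mscale tn (\d_(y : RR)))), q; split.
  by move=> x Ox; rewrite /U /bv_repr cumul_add cumul_mscale (cumul_dirac _ Oy)/=; ring.
rewrite Rintegral_measure_add// Rintegral_mscale// (Rintegral_dirac _ Oy)//=; lra.
Qed.

Lemma tailint_upper y : Om y -> 0 <= al y - Z y.
Proof.
move=> Oy.
have -> : al y - Z y = \int[mu]_(x in Om) (w x * (-1 * \1_(`[y, +oo[%classic) x)) + al y.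
  rewrite addrC tailint_indic; congr (_ + _); rewrite -[LHS]mulN1r -RintegralZl//.
    by apply: eq_Rintegral => x _; ring.
  by apply: bmeas_leb => //; exact: bmeasM.
apply: first_variation => [|t t0 t1]; first exact: bmeasZ.
pose tn : {nonneg R} := NngNum (ltW t0).
exists k, p, (measure_add q (mscale tn (\d_(y : RR)))); split.
  by move=> x Ox; rewrite /U /bv_repr cumul_add cumul_mscale (cumul_dirac _ Oy)/=; ring.
rewrite Rintegral_measure_add// Rintegral_mscale// (Rintegral_dirac _ Oy)//=; lra.
Qed.

Lemma integral_residual0 : \int[mu]_(x in Om) w x = 0.
Proof.
have H (s : R) : 0 <= \int[mu]_(x in Om) (w x * s) + 0.
  apply: first_variation => [|t t0 t1]; first exact: bmeas_cst.
  exists (k + t * s), p, q; split; first by move=> x _; rewrite /U /bv_repr; ring.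
  by rewrite mulr0 addr0.
have := H 1; have := H (-1); rewrite !addr0 !RintegralZr//; try exact: bmeas_leb.
rewrite mulr1 mulrN1 => h1 h2; apply/eqP; rewrite eq_le h2 andbT; lra.
Qed.

(* Since both integrands are nonnegative, this is complementary slackness. *)
Lemma slackness :
  \int[p]_(x in Om) (al x + Z x) + \int[q]_(x in Om) (al x - Z x) <= 0.
Proof.
have bZ : bmeas Z by exact: bmeas_tailint.
rewrite RintegralD//; [|exact: bmeas_fin..].
rewrite RintegralB//; [|exact: bmeas_fin..].
(* Shrinking [U] to [(1 - t) U] scales [p] and [q], so the cost decreases at the rate of the whole
   weighted variation. *)
have := @first_variation (fun x => -1 * U x)
  (- (\int[p]_(x in Om) al x + \int[q]_(x in Om) al x)) (bmeasZ _ bU).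
have -> : \int[mu]_(x in Om) (w x * (-1 * U x)) =
    - (\int[p]_(x in Om) Z x - \int[q]_(x in Om) Z x).
  rewrite -(fubini_repr ab k p q bw integral_residual0) -[RHS]mulN1r -RintegralZl//.
    by apply: eq_Rintegral => x _; rewrite /U; ring.
  by apply: bmeas_leb => //; exact: bmeasM.
move=> H; suff : 0 <= - (\int[p]_(x in Om) Z x - \int[q]_(x in Om) Z x) -
  (\int[p]_(x in Om) al x + \int[q]_(x in Om) al x) by lra.
apply: H => t t0 t1.
have s0 : 0 <= 1 - t by rewrite subr_ge0.
pose sn : {nonneg R} := NngNum s0.
exists ((1 - t) * k), (mscale sn p), (mscale sn q); split.
  by move=> x _; rewrite /U /bv_repr !cumul_mscale/=; ring.
rewrite !Rintegral_mscale//=; lra.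
Qed.

(* [ramp_lower] and [ramp_upper] bound [1 + ramp c Z] and [1 - ramp c Z] by
   multiples of the slacks [al + Z] and [al - Z]; this replaces the a.e.
   identity [- ramp c Z = sign of Du]. *)
Lemma minimizer_mass_le : (p Om + q Om <= pf Om + qf Om)%E.
Proof.
(* [P, Q] are the masses of [p, q]; [A, B] the integrals of [ramp c Z] against them; primes refer to
   [pf, qf]; [S, T] are the scaled slacks. *)
have arith (P Q P' Q' A B A' B' S T : R) : P + A <= S -> Q - B <= T ->
  S + T <= 0 -> - A - - B <= - A' - - B' -> - P' <= A' -> B' <= Q' ->
  P + Q <= P' + Q' by move=> *; lra.
have bZ : bmeas Z by exact: bmeas_tailint.
pose K := 8 * c ^- 2.
have K0 : 0 < c ^- 2 by rewrite invr_gt0 exprn_gt0.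
have lip (s r : R) : `|ramp' c s - ramp' c r| <= K * `|s - r| by exact: ramp'_lip.
have taylor (s r : R) : `|ramp c s - ramp c r - ramp' c r * (s - r)| <= K * (s - r) ^+ 2.
  rewrite (le_trans (ramp_taylor c0 s r))// ler_wpM2r ?sqr_ge0//.
  by rewrite ler_wpM2r ?(ltW K0)// ler_nat.
have beZ : bmeas (fun x => ramp' c (Z x)) by exact: bmeas_lipschitz_comp lip.
(* Chosen so that [tailint g = - ramp c Z], the [psi] of the overview. *)
pose g x := -1 * (ramp' c (Z x) * w x).
have bg : bmeas g by apply: bmeasZ; exact: bmeasM.
have tg y : tailint a b g y = - ramp c (Z y).
  rewrite tailintM ?mulN1r//; last exact: bmeasM.
  by rewrite (tailint_chain ab bw taylor lip)//; exact: ramp0.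
have g0 : \int[mu]_(x in Om) g x = 0.
  rewrite -(tailint_le b g (lexx a)) tg /Z (tailint_le _ _ (lexx a)).
  by rewrite integral_residual0 ramp0// oppr0.
have FU := fubini_repr ab k p q bg g0.
have FF := fubini_repr ab kf pf qf bg g0.
(* The factor [w = U - F] inside [g] produces the square. *)
have dec : \int[mu]_(x in Om) (U x * g x) <= \int[mu]_(x in Om) (F x * g x).
  apply: le_Rintegral => //.
  - by apply: bmeas_leb => //; exact: bmeasM.
  - by apply: bmeas_leb => //; exact: bmeasM.
  move=> x _; rewrite -subr_ge0.
  have -> : F x * g x - U x * g x = ramp' c (Z x) * (w x * w x).
    by rewrite /g /w; ring.
  by rewrite mulr_ge0 ?ramp'_ge0// -expr2 sqr_ge0.
have be : bmeas (fun x => ramp c (Z x)).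
  have bt : bmeas (fun x => - tailint a b g x) by apply: bmeasN; exact: bmeas_tailint.
  by rewrite (_ : (fun _ => _) = fun x => - tailint a b g x)//;
    apply/funext => x; rewrite tg opprK.
have tgE (m : fmeas) : \int[m]_(x in Om) tailint a b g x =
    - \int[m]_(x in Om) ramp c (Z x).
  rewrite -[RHS]mulN1r -RintegralZl//; last exact: bmeas_fin.
  by apply: eq_Rintegral => x _; rewrite tg mulN1r.
rewrite -/U FU -/F FF !tgE in dec.
have massE (m : fmeas) : \int[m]_(x in Om) (1 : R) = fine (m Om).
  by rewrite Rintegral_cst// mul1r.
have b1 : bmeas (fun _ : R => 1 : R) by exact: bmeas_cst.
have low : \int[p]_(x in Om) (1 + ramp c (Z x)) <=
    2 / c * \int[p]_(x in Om) (al x + Z x).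
  rewrite -RintegralZl//; last by apply: bmeas_fin; exact: bmeasD.
  apply: le_Rintegral => //.
  - by apply: bmeas_fin; exact: bmeasD.
  - by apply: bmeas_fin; apply: bmeasZ; exact: bmeasD.
  move=> x Ox; rewrite [al x + _]addrC; apply: ramp_lower => //; first exact: alc.
  by rewrite -sub0r lerBlDl; exact: tailint_lower.
have upp : \int[q]_(x in Om) (1 - ramp c (Z x)) <=
    2 / c * \int[q]_(x in Om) (al x - Z x).
  rewrite -RintegralZl//; last by apply: bmeas_fin; exact: bmeasB.
  apply: le_Rintegral => //.
  - by apply: bmeas_fin; exact: bmeasB.
  - by apply: bmeas_fin; apply: bmeasZ; exact: bmeasB.
  move=> x Ox; apply: ramp_upper => //; first exact: alc.
  by rewrite -subr_ge0; exact: tailint_upper.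
rewrite [X in X <= _]RintegralD ?massE// in low; [|exact: bmeas_fin..].
rewrite [X in X <= _]RintegralB ?massE// in upp; [|exact: bmeas_fin..].
have slack : 2 / c * \int[p]_(x in Om) (al x + Z x) +
    2 / c * \int[q]_(x in Om) (al x - Z x) <= 0.
  rewrite -mulrDr mulr_ge0_le0//; last exact: slackness.
  by rewrite divr_ge0// ltW.
have bnd (m : fmeas) : `|\int[m]_(x in Om) ramp c (Z x)| <= fine (m Om).
  rewrite (le_trans (le_normr_Rintegral _ _))//; first exact: bmeas_fin.
  rewrite -massE; apply: le_Rintegral => //; last by move=> x _; exact: ramp_le1.
  - by apply: integrable_norm; exact: bmeas_fin.
  - exact: bmeas_fin.
have := bnd pf; have := bnd qf; rewrite !ler_norml => /andP[h1 h2] /andP[h3 h4].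
suff : fine (p Om) + fine (q Om) <= fine (pf Om) + fine (qf Om).
  by rewrite -lee_fin !EFinD !fineK// fin_num_measure.
exact: arith low upp slack dec h3 h2.
Qed.

End Variation.

(** [alpha] is arbitrary outside [[a, b]], hence the extension by 0; boundedness comes from
    compactness of [[a, b]]. *)
Lemma continuous_itv_bmeas (R : realType) (a b : R) (alpha : R -> R) : a < b ->
  {within `[a, b], continuous alpha} -> bmeas (alpha \_ `]a, b[).
Proof.
move=> ab ac; split.
  apply/(measurable_restrictT _ (measurable_Omega a b)).
  apply: (@measurable_funS _ _ _ _ (`[a, b]%classic : set (measurableTypeR R))) => //.
    exact: subset_itv_oo_cc.
  by apply: subspace_continuous_measurable_fun.
have [|e _ le_e] := @EVT_max R (fun x => `|alpha x|) a b (ltW ab).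
  by move=> x; apply: continuous_comp; [exact: ac|exact: norm_continuous].
exists `|alpha e| => x; rewrite patchE; case: ifPn => [|_]; last by rewrite normr0.
by rewrite mem_setE => xab; apply: le_e; exact: subset_itv_oo_cc xab.
Qed.

Unset Implicit Arguments.

Theorem theorem4p2 (R : realType) (a b : R) (hab : a < b)
  (alpha : R -> R)
  (alpha_cont : {within `[a, b], continuous alpha})
  (alpha_diff : forall x : R, x \in `]a, b[ -> derivable alpha x 1)
  (alpha_gt0 : forall x : R, x \in `[a, b] -> 0 < alpha x)
  (f u : BV a b)
  (u_argmin : is_minimizer alpha f u) :
  (tv_measure (D u) `]a, b[%classic <= tv_measure (D f) `]a, b[%classic)%E.
Proof.
have bal := continuous_itv_bmeas hab alpha_cont.
(* The threshold [c] of the ramp will be the minimum [alpha e]. *)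
have [e eab le_e] := EVT_min (ltW hab) alpha_cont.
have alE x : `]a, b[%classic x -> alpha x = (alpha \_ `]a, b[) x.
  by move=> xab; rewrite patchE mem_set.
have al_ge0 x : 0 <= (alpha \_ `]a, b[) x.
  rewrite patchE; case: ifPn => //; rewrite mem_setE => xab.
  by rewrite ltW// alpha_gt0//; exact: subset_itv_oo_cc xab.
have [ku [kf H]] := minimizer_repr hab bal al_ge0 alE u_argmin.
have al_e x : `]a, b[%classic x -> alpha e <= (alpha \_ `]a, b[) x.
  by move=> xab; rewrite -alE//; apply: le_e; exact: subset_itv_oo_cc xab.
exact: (minimizer_mass_le hab bal (alpha_gt0 _ eab) al_e H).
Qed.
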